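(* Let $\Lambda$ be a left hereditary ring. The following conditions are equivalent: (1) $\Lambda$ is a QF-$3^{+}$ ring; (2) $\Lambda$ is left perfect and right coherent, and, moreover, $\Lambda\text{-}Mod_{St}$ is a Serre subcategory of $\Lambda\text{-}Mod$; (3) $\Lambda$ is left perfect and right coherent, and, moreover, $\Lambda\text{-}Mod_{St}$ is a localizing subcategory of $\Lambda\text{-}Mod$; (4) $\Lambda$ is left perfect and right coherent, and, moreover, for any module $M$ one has $\mathbf{R}(M)=\bigcap_{f:M\to I({}_\Lambda\Lambda)}\operatorname{Ker} f$, where $f$ runs over all $\Lambda$-homomorphisms $M\to I({}_\Lambda\Lambda)$; (5) $\Lambda$ is left perfect and right coherent, and, moreover, no stable module contains a nonzero projective submodule; (6) the subcategory $\Lambda\text{-}Mod_{Pr}$ of $\Lambda\text{-}Mod$ is reflective, and, moreover, the reflector $\mathbf{r}:\Lambda\text{-}Mod\to\Lambda\text{-}Mod_{Pr}$ preserves monomorphisms; (7) the subcategory $\Lambda\text{-}Mod_{Pr}$ of $\Lambda\text{-}Mod$ is reflective, and, moreover, the image of the embedding ${}_\Lambda\Lambda\rightarrowtail I({}_\Lambda\Lambda)$ under the reflector $\mathbf{r}$ is a monomorphism.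
   Context: Rings are associative with identity; ''module'' means left unital $\Lambda$-module; $\Lambda\text{-}Mod$ is the category of modules; ${}_\Lambda\Lambda$ is $\Lambda$ as a left module over itself; $I(M)$ is the injective envelope of $M$. A ring is left QF-$3^{+}$ if $I({}_\Lambda\Lambda)$ is projective; for left hereditary rings this notion is left-right symmetric, so one says simply QF-$3^{+}$. A module is stable if it has no nonzero projective direct summands. $\Lambda\text{-}Mod_{St}$ and $\Lambda\text{-}Mod_{Pr}$ are the full subcategories of stable and of projective modules. $\mathbf{R}(M)$ is the largest stable submodule of $M$ (it exists for every $M$ when $\Lambda$ is left hereditary). A Serre subcategory is a full subcategory closed under submodules, quotients and extensions; a localizing subcategory is a Serre subcategory closed under arbitrary direct sums. *)

(* Defs.v *)
From HB Require Import structures.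
From mathcomp Require Import all_boot all_order all_algebra.

Set Implicit Arguments.
Unset Strict Implicit.
Unset Printing Implicit Defensive.

Import GRing.Theory.
Local Open Scope ring_scope.

Definition surjective (A B : Type) (f : A -> B) : Prop := forall y, exists x, f x = y.

(* A submodule of M is a submodClosed M, i.e., a boolean predicate on M; in the
   presence of classical axioms every Prop-valued submodule is of this form.
   [submodule_of A] is A regarded as a module in its own right. *)
Definition submodule_of (R : pzRingType) (M : lmodType R) (A : submodClosed M) : Type :=
  {x : M | x \in A}.

HB.instance Definition _ (R : pzRingType) (M : lmodType R) (A : submodClosed M) :=
  SubChoice.on (submodule_of A).
HB.instance Definition _ (R : pzRingType) (M : lmodType R) (A : submodClosed M) :=
  [SubChoice_isSubLmodule of submodule_of A by <:].

Section Modules.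
Variable R : pzRingType.
Implicit Types M N P Q E : lmodType R.

Definition zero_submodule M (A : submodClosed M) : Prop :=
  forall x, x \in A -> x = 0.

Definition projective P : Prop :=
  forall M N (p : {linear M -> N}) (f : {linear P -> N}), surjective p ->
  exists g : {linear P -> M}, forall x, p (g x) = f x.

Definition injective_module E : Prop :=
  forall M N (i : {linear M -> N}) (f : {linear M -> E}), injective i ->
  exists g : {linear N -> E}, forall x, g (i x) = f x.

Definition essential M E (i : {linear M -> E}) : Prop :=
  forall A : submodClosed E, (forall x, i x \in A -> i x = 0) -> zero_submodule A.

Definition injective_envelope M E (i : {linear M -> E}) : Prop :=
  [/\ injective_module E, injective i & essential i].

Definition superfluous P (K : P -> Prop) : Prop :=
  forall A : submodClosed P,
  (forall x, exists k a, [/\ K k, a \in A & x = k + a]) -> forall x, x \in A.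

Definition projective_cover P M (p : {linear P -> M}) : Prop :=
  [/\ projective P, surjective p & superfluous (fun x => p x = 0)].

Definition left_hereditary : Prop :=
  forall L : submodClosed R^o, projective (submodule_of L).

Definition left_QF3plus : Prop :=
  exists E (i : {linear R^o -> E}), injective_envelope i /\ projective E.

Definition left_perfect : Prop :=
  forall M, exists P (p : {linear P -> M}), projective_cover p.

Definition finitely_generated M : Prop :=
  exists n (f : {linear 'rV[R]_n -> M}), surjective f.

(* an exact sequence R^m -> R^n -> M -> 0 *)
Definition finitely_presented M : Prop :=
  exists m n (g : {linear 'rV[R]_m -> 'rV[R]_n}) (f : {linear 'rV[R]_n -> M}),
  surjective f /\ (forall y, f y = 0 <-> exists x, g x = y).

Definition left_coherent : Prop :=
  forall L : submodClosed R^o,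
  finitely_generated (submodule_of L) -> finitely_presented (submodule_of L).

Definition direct_summand M (A : submodClosed M) : Prop :=
  exists B : submodClosed M,
  (forall x, exists a b, [/\ a \in A, b \in B & x = a + b]) /\
  (forall x, x \in A -> x \in B -> x = 0).

Definition stable M : Prop :=
  forall A : submodClosed M,
  direct_summand A -> projective (submodule_of A) -> zero_submodule A.

Definition largest_stable_submodule M (S : submodClosed M) : Prop :=
  stable (submodule_of S) /\
  (forall T : submodClosed M, stable (submodule_of T) -> {subset T <= S}).

Definition short_exact M N Q (i : {linear M -> N}) (p : {linear N -> Q}) : Prop :=
  [/\ injective i, surjective p & forall y, p y = 0 <-> exists x, i x = y].

(* Full subcategories of the category of R-modules are given by their classes
   of objects. *)

Definition serre (C : lmodType R -> Prop) : Prop :=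
  [/\ forall M N (i : {linear M -> N}), injective i -> C N -> C M,
      forall M N (p : {linear M -> N}), surjective p -> C M -> C N
    & forall M N Q (i : {linear M -> N}) (p : {linear N -> Q}),
        short_exact i p -> C M -> C Q -> C N].

Definition is_direct_sum (J : Type) (F : J -> lmodType R) (D : lmodType R)
    (inj : forall j, {linear F j -> D}) : Prop :=
  forall N (f : forall j, {linear F j -> N}),
  exists g : {linear D -> N}, (forall j x, g (inj j x) = f j x) /\
    (forall h : {linear D -> N}, (forall j x, h (inj j x) = f j x) -> h =1 g).

Definition localizing (C : lmodType R -> Prop) : Prop :=
  serre C /\
  (forall (J : Type) (F : J -> lmodType R) (D : lmodType R)
          (inj : forall j, {linear F j -> D}),
     is_direct_sum inj -> (forall j, C (F j)) -> C D).

Definition monomorphism_in (C : lmodType R -> Prop) M N (f : {linear M -> N}) : Prop :=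
  forall Q, C Q -> forall g h : {linear Q -> M},
  (forall x, f (g x) = f (h x)) -> g =1 h.

Definition monomorphism M N (f : {linear M -> N}) : Prop :=
  monomorphism_in (fun _ => True) f.

(* A left adjoint of the inclusion of the full subcategory C, given by its unit.
   The functor laws for [refl_map] follow from naturality of the unit and the
   uniqueness part of [refl_univ]. *)
Record reflector (C : lmodType R -> Prop) := Reflector {
  refl_obj : lmodType R -> lmodType R;
  refl_in : forall M, C (refl_obj M);
  refl_map : forall M N, {linear M -> N} -> {linear refl_obj M -> refl_obj N};
  refl_unit : forall M, {linear M -> refl_obj M};
  refl_natural : forall M N (f : {linear M -> N}) x,
    refl_map f (refl_unit M x) = refl_unit N (f x);
  refl_univ : forall M Q (f : {linear M -> Q}), C Q ->
    exists g : {linear refl_obj M -> Q}, (forall x, g (refl_unit M x) = f x) /\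
      (forall h : {linear refl_obj M -> Q},
         (forall x, h (refl_unit M x) = f x) -> h =1 g)
}.

Definition preserves_monomorphisms (C : lmodType R -> Prop) (r : reflector C) : Prop :=
  forall M N (f : {linear M -> N}),
  monomorphism f -> monomorphism_in C (refl_map r f).

End Modules.

(* Right R-modules are the left modules over the converse ring R^c. *)
Definition right_coherent (R : pzRingType) : Prop := left_coherent R^c.

(* Main.v *)
From HB Require Import structures.
From mathcomp Require Import all_boot all_order all_algebra.
From mathcomp Require Import boolp classical_sets functions.
Require Import Defs.

(** A module over a left hereditary ring is projective iff it has a locally
    finite separating family of functionals to [R]; hence submodules of projectives
    are projective, kernels of maps to projectives are direct summands, and [M] is
    stable iff it has no nonzero map to [R].  Given this, the implications
    (2) -> (3) -> (4) -> (5) and (6) -> (7) -> (1) only use injectivity of [I] and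
    essentiality of [R] in [I].

    (5) -> (6).  As in Chase's theorem, left perfect and right coherent make every
    power of [R] projective, so the image of [M] in [R ^ Hom(M, R)] is a projective
    reflection of [M].

    (1) -> (2).  If [I] is projective then it is finitely generated.  It is even
    noetherian: otherwise it contains independent elements [x (a, b)]; for
    [f : nat -> nat] let [E f] be the injective hull inside [I] of the span of the
    [x (a, b)] with [b <= f a].  The [E f] are finitely generated, and the
    projectivity of their union fails by a diagonal argument.  So [R] is left
    noetherian, hence right coherent, as annihilators are generated by idempotents.
    An element with zero left annihilator extends to an automorphism of [I], and by
    noetherianity it is a unit; therefore minimal idempotents [e] have division rings
    [e R e], [1] is a sum of such idempotents, and the ideal of all [r] such that
    [e r R e = 0] for all of them is nilpotent.  Projective covers are built as
    maximal direct sums of modules [R e] independent modulo this radical. *)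

Set Implicit Arguments.
Unset Strict Implicit.
Unset Printing Implicit Defensive.

Import GRing.Theory.
Local Open Scope ring_scope.

(** * Submodules and linear maps given by graphs *)

(** Zorn is run on the sets whose union with [A0] satisfies [P]: the empty chain then only needs
    [PA0], and [Pchain] is confined to nonempty chains. *)
Lemma zorn_above (T : Type) (P : set (set T)) (A0 : set T) :
  P A0 ->
  (forall F : set (set T), (F !=set0)%classic -> (F `<=` P)%classic ->
     total_on F subset -> P (\bigcup_(X in F) X)%classic) ->
  exists A, [/\ P A, (A0 `<=` A)%classic &
                forall B, (A `<=` B)%classic -> P B -> (B `<=` A)%classic].
Proof.
move=> PA0 Pchain.
have [|A [PA maxA]] := @Zorn_bigcup T (fun X => P (X `|` A0)%classic).
  move=> F FP Ftot; have [[X0 FX0]|F0] := pselect (F !=set0)%classic; last first.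
    rewrite (_ : (\bigcup_(X in F) X `|` A0 = A0)%classic) //.
    by apply/seteqP; split=> [x [[X FX]|]|x]; [case: F0; exists X| |right].
  pose F' : set (set T) := [set Y | exists2 X, F X & Y = (X `|` A0)%classic]%classic.
  rewrite (_ : (\bigcup_(X in F) X `|` A0 = \bigcup_(Y in F') Y)%classic).
    apply: Pchain; first by exists (X0 `|` A0)%classic, X0.
      by move=> _ [X FX ->]; apply: FP.
    move=> _ _ [X FX ->] [Y FY ->].
    by have [XY|YX] := Ftot _ _ FX FY; [left|right]; apply: setSU.
  apply/seteqP; split=> [x [[X FX Xx]|A0x]|x [_ [X FX ->] [Xx|A0x]]].
  - by exists (X `|` A0)%classic; [exists X|left].
  - by exists (X0 `|` A0)%classic; [exists X0|right].
  - by left; exists X.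
  - by right.
exists (A `|` A0)%classic; split=> // B AB PB.
have [BA|/existsNP[x /not_implyP[Bx nAx]]] := pselect (B `<=` A `|` A0)%classic.
  by [].
exfalso; apply: (maxA B).
  by split=> [y Ay|BA]; [apply: AB; left|apply: nAx; left; apply: BA].
by rewrite (_ : (B `|` A0)%classic = B) //; apply/setUidPl => y A0y; apply: AB; right.
Qed.

Lemma eq_big_support (V : nmodType) (X : eqType) (F : X -> V) (s t : seq X) :
  uniq s -> uniq t ->
  (forall x, x \notin s -> F x = 0) -> (forall x, x \notin t -> F x = 0) ->
  \sum_(x <- s) F x = \sum_(x <- t) F x.
Proof.
move=> us ut s0 t0.
have sub (u v : seq X) : (forall x, x \notin v -> F x = 0) ->
    \sum_(x <- u) F x = \sum_(x <- [seq x <- u | x \in v]) F x.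
  move=> v0; rewrite big_filter [RHS]big_mkcond /=.
  by apply: eq_bigr => x _; case: ifPn => // /v0.
rewrite (sub s t) // (sub t s) //; apply: perm_big.
apply: uniq_perm; rewrite ?filter_uniq // => x.
by rewrite !mem_filter andbC.
Qed.

Section Modules.
Variable R : pzRingType.
Implicit Types M N P Q E : lmodType R.

Definition is_submod M (P : M -> Prop) : Prop :=
  P 0 /\ forall a x y, P x -> P y -> P (a *: x + y).

(** The closure proof is an argument so that the [submodClosed] instance can be found from the term;
    [lin_fun] does the same for linearity. *)
Definition sub_pred M (P : M -> Prop) (_ : is_submod P) : {pred M} :=
  fun x => `[< P x >].

Lemma sub_pred_closed M (P : M -> Prop) (hP : is_submod P) :
  GRing.submod_closed (sub_pred hP).
Proof.
split; first exact/asboolP/hP.1.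
by move=> a x y /asboolP Px /asboolP Py; exact/asboolP/hP.2.
Qed.

HB.instance Definition _ M (P : M -> Prop) (hP : is_submod P) :=
  GRing.isSubmodClosed.Build R M (sub_pred hP)
    (GRing.submod_closed_semi (sub_pred_closed hP)).

Definition sub_of M (P : M -> Prop) (hP : is_submod P) : submodClosed M :=
  sub_pred hP.

Lemma sub_ofP M (P : M -> Prop) (hP : is_submod P) x :
  x \in sub_of hP <-> P x.
Proof. by split=> [/asboolP|Px]; [|exact/asboolP]. Qed.

Definition lin_fun M N (f : M -> N) (_ : linear f) : M -> N := f.

HB.instance Definition _ M N (f : M -> N) (hf : linear f) :=
  GRing.isLinear.Build R M N _ (lin_fun hf) hf.

Definition lin_of M N (f : M -> N) (hf : linear f) : {linear M -> N} := lin_fun hf.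

Lemma lin_ofE M N (f : M -> N) (hf : linear f) x : lin_of hf x = f x.
Proof. by []. Qed.

Lemma corestr_linear M N (f : {linear M -> N}) (A : submodClosed N)
  (h : forall x, f x \in A) : linear (fun x => Sub (f x) (h x) : submodule_of A).
Proof. by move=> a x y; apply: val_inj; rewrite /= linearP. Qed.

Definition corestr M N (f : {linear M -> N}) (A : submodClosed N)
  (h : forall x, f x \in A) : {linear M -> submodule_of A} := lin_of (corestr_linear h).

Definition incl M (A : submodClosed M) : {linear submodule_of A -> M} := \val.

Lemma incl_inj M (A : submodClosed M) : injective (incl A).
Proof. exact: val_inj. Qed.

Lemma submod_opp M (A : submodClosed M) x : x \in A -> - x \in A.
Proof. by rewrite -scaleN1r; exact: rpredZ. Qed.

Lemma submod_sub M (A : submodClosed M) x y : x \in A -> y \in A -> x - y \in A.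
Proof. by move=> xA yA; rewrite rpredD // submod_opp. Qed.

(** Linearity with scalar -1 and the condition at 0 make the relation single valued. Maps on images
    and quotients are defined below in this way. *)
Lemma graph_linear M N (G : M -> N -> Prop) :
  (forall x, exists y, G x y) ->
  (forall a x y x' y', G x y -> G x' y' -> G (a *: x + x') (a *: y + y')) ->
  (forall y, G 0 y -> y = 0) ->
  exists g : {linear M -> N}, forall x y, G x y -> g x = y.
Proof.
move=> /choice[g Gg] Glin G0.
have Guniq x y y' : G x y -> G x y' -> y = y'.
  move=> Gy Gy'; have := Glin (-1) _ _ _ _ Gy Gy'.
  by rewrite !scaleN1r addNr => /G0/eqP; rewrite addrC subr_eq0 => /eqP.
have gl : linear g by move=> a x y; apply: Guniq (Gg _) (Glin _ _ _ _ _ (Gg _) (Gg _)).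
by exists (lin_of gl) => x y; apply: Guniq; exact: Gg.
Qed.

Lemma injective_extend_graph M E (G : M -> E -> Prop) :
  injective_module E -> G 0 0 ->
  (forall a x y x' y', G x y -> G x' y' -> G (a *: x + x') (a *: y + y')) ->
  (forall y, G 0 y -> y = 0) ->
  exists g : {linear M -> E}, forall x y, G x y -> g x = y.
Proof.
move=> injE G00 Glin G0.
have hD : is_submod (fun x => exists y, G x y).
  split; first by exists 0.
  by move=> a x x' [y Gy] [y' Gy']; exists (a *: y + y'); apply: Glin.
have [||y|f fP] := @graph_linear (submodule_of (sub_of hD)) E
    (fun x y => G (val x) y).
- by move=> x; have /sub_ofP := valP x.
- by move=> a x y x' y' Gx Gx'; rewrite linearP; apply: Glin.
- by rewrite linear0; exact: G0.
have [g gP] := injE _ _ (incl (sub_of hD)) f val_inj.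
exists g => x y Gxy.
have xD : x \in sub_of hD by apply/sub_ofP; exists y.
by rewrite -(fP (Sub x xD) y) //= -gP.
Qed.

End Modules.

(** * Projective modules over left hereditary rings *)

Section Projective.
Variable R : pzRingType.
Implicit Types A M N P Q E : lmodType R.

Definition locally_finite M (X : eqType) (phi : X -> {linear M -> R^o}) : Prop :=
  forall a, exists s : seq X, forall x, x \notin s -> phi x a = 0.

Definition separating M (X : Type) (phi : X -> {linear M -> R^o}) : Prop :=
  forall a, (forall x, phi x a = 0) -> a = 0.

Section Hereditary.
Hypothesis hR : left_hereditary R.

Section Lift.
Variables (A M N : lmodType R) (X : eqType) (phi : X -> {linear A -> R^o}).
Variables (p : {linear M -> N}) (f : {linear A -> N}).
Hypothesis p_surj : surjective p.

(* A set of [X + A * M] encodes a set [S] of coordinates together with the graph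
   of a lift of [f] to the elements of [A] supported on [S]. *)
Definition partial_lift (Z : set (X + A * M)) : Prop :=
  let G a m := Z (inr (a, m)) in
  [/\ (G 0 0 /\ forall c a m a' m', G a m -> G a' m' -> G (c *: a + a') (c *: m + m')),
      (forall m, G 0 m -> m = 0),
      (forall a m, G a m -> p m = f a),
      (forall a m x, G a m -> ~ Z (inl x) -> phi x a = 0)
    & (forall a, (forall x, ~ Z (inl x) -> phi x a = 0) -> exists m, G a m)].

Lemma partial_lift_bigcup (F : set (set (X + A * M))) : locally_finite phi ->
  (F !=set0)%classic -> (F `<=` partial_lift)%classic -> total_on F subset ->
  partial_lift (\bigcup_(Z in F) Z)%classic.
Proof.
move=> lf [Z0 FZ0] FP Ftot; split.
- split; first by exists Z0 => //; have [[]] := FP _ FZ0.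
  move=> c a m a' m' [Z FZ Zam] [Z' FZ' Z'am].
  have [/(_ _ Zam) Zam'|/(_ _ Z'am) Z'am'] := Ftot _ _ FZ FZ'.
    by exists Z' => //; have [[_ Zl] _ _ _ _] := FP _ FZ'; apply: Zl.
  by exists Z => //; have [[_ Zl] _ _ _ _] := FP _ FZ; apply: Zl.
- by move=> m [Z FZ Zm]; have [_ Z_0 _ _ _] := FP _ FZ; apply: Z_0.
- by move=> a m [Z FZ Zm]; have [_ _ Z_0 _ _] := FP _ FZ; apply: Z_0.
- move=> a m x [Z FZ Zm] nx; have [_ _ _ Z_0 _] := FP _ FZ; apply: Z_0 Zm _.
  by move=> Zx; apply: nx; exists Z.
- move=> a aS; have [s sP] := lf a.
  (* The support of [a] is finite, so one member of the chain contains all the coordinates that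
     matter. *)
  have [Z FZ sZ] : exists2 Z, F Z & forall x, x \in s ->
      (\bigcup_(Z in F) Z)%classic (inl x) -> Z (inl x).
    elim: s {sP} => [|x s [Z FZ sZ]]; first by exists Z0.
    have [[Z' FZ' Z'x]|nx] := pselect ((\bigcup_(Z in F) Z)%classic (inl x)); last first.
      by exists Z => // y; rewrite inE => /orP[/eqP-> //|/sZ].
    have [ZZ'|Z'Z] := Ftot _ _ FZ FZ'.
      by exists Z' => // y; rewrite inE => /orP[/eqP-> //|ys yU]; apply/ZZ'/sZ.
    by exists Z => // y; rewrite inE => /orP[/eqP-> _|ys yU]; [apply: Z'Z|apply: sZ].
  have [_ _ _ _ /(_ a)[|m Zm]] := FP _ FZ; last by exists m, Z.
  move=> x nZx; have [xs|xs] := boolP (x \in s); last exact: sP.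
  by apply: aS => xU; apply: nZx; apply: sZ.
Qed.

(** On the elements supported on the old coordinates and [x0], the map [phi x0] has a left ideal [L]
    as image. As [L] is projective, there are a section [j] and a lift [k] of [f] along it; an
    element is its part [j l] plus an element supported on the old coordinates. *)
Lemma partial_lift_extend (Z : set (X + A * M)) (x0 : X) :
  partial_lift Z -> ~ Z (inl x0) ->
  exists Z', [/\ partial_lift Z', (Z `<=` Z')%classic & Z' (inl x0)].
Proof.
move=> [[G0 Gl] Gf Gp GS Gt] nx0.
have hD : is_submod (fun a => forall x, x <> x0 -> ~ Z (inl x) -> phi x a = 0).
  split=> [x _ _|c a b ha hb x xx0 nx]; first by rewrite linear0.
  by rewrite linearP /= ha // hb // scaler0 addr0.
have hL : @is_submod R R^o (fun r => exists2 a, a \in sub_of hD & phi x0 a = r).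
  split; first by exists 0; rewrite ?rpred0 ?linear0.
  move=> c r r' [a aD <-] [a' a'D <-].
  by exists (c *: a + a'); rewrite ?rpredD ?rpredZ // linearP.
have qL (a : submodule_of (sub_of hD)) : (phi x0 \o incl _) a \in sub_of hL.
  by apply/sub_ofP; exists (val a) => //; exact: valP.
have [|j jP] := @hR (sub_of hL) _ _ (corestr qL) idfun.
  move=> l; have /sub_ofP[a aD al] := valP l.
  by exists (Sub a aD); apply: val_inj.
have [k kP] := @hR (sub_of hL) _ _ p (f \o (incl _ \o j)) p_surj.
have jD l x : x <> x0 -> ~ Z (inl x) -> phi x (val (j l)) = 0.
  by have /sub_ofP := valP (j l); apply.
have jx l : phi x0 (val (j l)) = val l by have /(congr1 val) := jP l.
exists (fun z => match z with
  | inl x => Z (inl x) \/ x = x0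
  | inr (a, m) => exists l, Z (inr (a - val (j l), m - k l)) end).
split; last 2 first.
- move=> [x|[a m]] Zz; first by left.
  by exists 0; rewrite !linear0 /= !addr0.
- by right.
split.
- split; first by exists 0; rewrite !linear0 /= !addr0.
  move=> c a m a' m' [l Gam] [l' Gam']; exists (c *: l + l').
  have -> : c *: m + m' - k (c *: l + l') = c *: (m - k l) + (m' - k l').
    by rewrite linearP scalerBr opprD addrACA.
  have -> : c *: a + a' - val (j (c *: l + l')) = c *: (a - val (j l)) + (a' - val (j l')).
    by rewrite linearP scalerBr /= opprD addrACA.
  exact: Gl.
- move=> m [l]; rewrite sub0r => Gm.
  have /eqP := GS _ _ _ Gm nx0; rewrite linearN /= oppr_eq0 jx => /eqP l0.
  have {}l0 : l = 0 by apply: val_inj; rewrite l0.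
  by move: Gm; rewrite l0 !linear0 /= addr0 => /Gf.
- move=> a m [l /Gp]; rewrite !linearB kP /= => /eqP.
  by rewrite subr_eq subrK => /eqP.
- move=> a m x [l Gm] /not_orP[nx xx0].
  have := GS _ _ _ Gm nx; rewrite linearB /= jD // subr0 //.
- move=> a aS.
  have aD : a \in sub_of hD by apply/sub_ofP => x xx0 nx; apply: aS => -[].
  pose l := corestr qL (Sub a aD).
  have [|m Gm] := Gt (a - val (j l)); last first.
    by exists (m + k l), l; rewrite addrK.
  move=> x nx; rewrite linearB /=.
  have [->|xx0] := pselect (x = x0); first by rewrite jx subrr.
  by rewrite jD // aS ?subrr // => -[].
Qed.

Lemma lift_locally_finite : locally_finite phi -> separating phi ->
  exists g : {linear A -> M}, forall a, p (g a) = f a.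
Proof.
move=> lf sep.
(* The starting point has no coordinates and the graph of 0; it is a partial lift because [phi] is
   separating. *)
have [||Z [PZ _ Zmax]] := @zorn_above (X + A * M)%type partial_lift
    (fun z => if z is inr am then am = (0, 0) else False).
- split=> //.
  + split=> // c a m a' m' [-> ->] [-> ->]; by rewrite !scaler0 !addr0.
  + by move=> m [].
  + by move=> a m [-> ->]; rewrite !linear0.
  + by move=> a m x [-> _] _; rewrite linear0.
  + by move=> a aS; exists 0; rewrite (sep a) // => x; apply: aS.
- by move=> F F0 FP Ft; apply: partial_lift_bigcup.
have Zall x : Z (inl x).
  apply: contrapT => nx; have [Z' [PZ' ZZ' Z'x]] := partial_lift_extend PZ nx.
  exact/nx/(Zmax Z').
have [[_ Gl] Gf Gp _ Gt] := PZ.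
have [a|//|//|g gP] := @graph_linear R A M (fun a m => Z (inr (a, m))).
  by apply: Gt => x /(_ (Zall x)).
exists g => a; have [|m Gm] := Gt a; first by move=> x /(_ (Zall x)).
by rewrite (gP _ _ Gm); apply: Gp.
Qed.

End Lift.

Lemma projective_locally_finite A (X : eqType) (phi : X -> {linear A -> R^o}) :
  locally_finite phi -> separating phi -> projective A.
Proof. by move=> lf sep M N p f ps; exact: (lift_locally_finite f ps lf sep). Qed.

End Hereditary.

Section Free.
Variable X : eqType.

Lemma finite_support_submod : @is_submod R (X -> R^o)
  (fun f => exists s : seq X, forall x, x \notin s -> f x = 0).
Proof.
split; first by exists [::].
move=> c f g [s sP] [t tP]; exists (s ++ t) => x.
rewrite mem_cat negb_or => /andP[/sP fx /tP gx].
by rewrite /= /GRing.add /GRing.scale /= fx gx scaler0 addr0.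
Qed.

Definition free_mod : lmodType R := submodule_of (sub_of finite_support_submod).

(** The value is given for every duplicate-free list containing the support, so that later proofs
    may choose the list. *)
Lemma free_mod_eval M (g : X -> M) : exists h : {linear free_mod -> M},
  forall (f : free_mod) s, uniq s -> (forall x, x \notin s -> val f x = 0) ->
  h f = \sum_(x <- s) (val f x : R) *: g x.
Proof.
pose G (f : free_mod) m := exists s, [/\ uniq s,
  forall x, x \notin s -> val f x = 0 & m = \sum_(x <- s) (val f x : R) *: g x].
have Gu f m s : G f m -> uniq s -> (forall x, x \notin s -> val f x = 0) ->
    m = \sum_(x <- s) (val f x : R) *: g x.
  move=> [t [ut t0 ->]] us s0; apply: eq_big_support => // x; first by move=> /t0->; rewrite scale0r.
  by move=> /s0->; rewrite scale0r.
have [|||h hP] := @graph_linear R free_mod M G.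
- move=> f; have /sub_ofP[s sP] := valP f.
  exists (\sum_(x <- undup s) (val f x : R) *: g x), (undup s).
  by split; rewrite ?undup_uniq // => x; rewrite mem_undup; exact: sP.
- move=> c f m f' m' Gf Gf'.
  have [s [us s0 _]] := Gf; have [s' [us' s0' _]] := Gf'.
  have t0 x : x \notin undup (s ++ s') -> val f x = 0 /\ val f' x = 0.
    by rewrite mem_undup mem_cat negb_or => /andP[/s0 -> /s0' ->].
  exists (undup (s ++ s')); split; first exact: undup_uniq.
    by move=> x /t0[fx f'x]; rewrite linearP /= /GRing.add /GRing.scale /= fx f'x scaler0 addr0.
  rewrite (Gu _ _ _ Gf (undup_uniq (s ++ s'))); last by move=> x /t0[].
  rewrite (Gu _ _ _ Gf' (undup_uniq (s ++ s'))); last by move=> x /t0[].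
  rewrite scaler_sumr -big_split /=; apply: eq_bigr => x _.
  by rewrite scalerA -scalerDl.
- by move=> m [s [_ _ ->]]; rewrite big1 // => x _; rewrite linear0 scale0r.
exists h => f s us s0.
by apply: hP; exists s.
Qed.

Lemma free_single_proof (i : X) (c : R) :
  (fun x => if x == i then c else 0 : R^o) \in sub_of finite_support_submod.
Proof.
apply/(sub_ofP finite_support_submod).
by exists [:: i] => x; rewrite inE => /negbTE ->.
Qed.

Definition free_single (i : X) (c : R) : free_mod :=
  Sub (fun x => if x == i then c else 0 : R^o) (free_single_proof i c)
    : submodule_of (sub_of finite_support_submod).

Lemma free_singleE i c x : val (free_single i c) x = if x == i then c else 0.
Proof. by []. Qed.

Lemma free_ext (f g : free_mod) : (forall x, val f x = val g x) -> f = g.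
Proof. by move=> fg; apply: incl_inj; apply/funext. Qed.

Lemma coord_linear (x : X) : linear (fun f : free_mod => val f x : R^o).
Proof. by move=> c f g; rewrite linearP. Qed.

Definition free_coord (x : X) : {linear free_mod -> R^o} := lin_of (coord_linear x).

Lemma free_mod_val_sum (J : Type) (t : seq J) (f : J -> free_mod) x :
  val (\sum_(j <- t) f j) x = \sum_(j <- t) val (f j) x.
Proof. by rewrite -[LHS]/(free_coord x (\sum_(j <- t) f j)) linear_sum. Qed.

Lemma free_mod_sum_single (f : free_mod) (t : seq X) : uniq t ->
  (forall x, x \notin t -> val f x = 0) -> f = \sum_(x <- t) free_single x (val f x).
Proof.
move=> ut t0; apply: free_ext => x; rewrite free_mod_val_sum.
have [xt|/[dup] xt /t0 ->] := boolP (x \in t).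
  rewrite (bigD1_seq x) //= eqxx big1 ?addr0 // => y yx.
  by rewrite eq_sym (negbTE yx).
rewrite big_seq big1 // => y yt; rewrite free_singleE.
by case: eqP => // xy; rewrite xy yt in xt.
Qed.


End Free.

(** The set [P] itself indexes the basis: [phi y] is the coordinate at [y] of a splitting of the
    canonical map from the free module on [P]. *)
Lemma dual_basis P : projective P ->
  exists phi : P -> {linear P -> R^o}, locally_finite phi /\
    forall x s, uniq s -> (forall y, y \notin s -> phi y x = 0) ->
    x = \sum_(y <- s) (phi y x : R) *: y.
Proof.
move=> projP; have [h hP] := free_mod_eval (fun x : P => x).
have [|j jP] := projP _ _ h idfun.
  move=> y; exists (free_single y 1).
  rewrite (hP _ [:: y]) //; first by rewrite big_seq1 free_singleE eqxx scale1r.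
  by move=> x; rewrite inE free_singleE => /negbTE ->.
exists (fun y => free_coord y \o j); split=> [x|x s us s0].
  by have /sub_ofP[s sP] := valP (j x); exists s.
by rewrite -[LHS]jP (hP _ s).
Qed.

End Projective.

(** * Stable modules *)

Section Splitting.
Variable R : pzRingType.
Implicit Types A M N P Q E : lmodType R.

Lemma linear_inj M N (f : {linear M -> N}) : (forall x, f x = 0 -> x = 0) -> injective f.
Proof.
move=> f0 x y fxy; apply/eqP; rewrite -subr_eq0; apply/eqP/f0.
by rewrite linearB fxy subrr.
Qed.

Lemma inj_linear0 M N (f : {linear M -> N}) x : injective f -> f x = 0 -> x = 0.
Proof. by move=> fi fx; apply: fi; rewrite linear0. Qed.

Lemma full_submod M : is_submod (fun _ : M => True).
Proof. by []. Qed.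

Lemma ker_submod M N (f : {linear M -> N}) : is_submod (fun x => f x = 0).
Proof. by split=> [|a x y fx fy]; rewrite ?linear0 // linearP fx fy scaler0 addr0. Qed.

Lemma im_submod M N (f : {linear M -> N}) : is_submod (fun y => exists x, f x = y).
Proof.
split; first by exists 0; rewrite linear0.
by move=> a _ _ [x <-] [y <-]; exists (a *: x + y); rewrite linearP.
Qed.

Lemma preim_submod M N (f : {linear M -> N}) (A : submodClosed N) :
  is_submod (fun x => f x \in A).
Proof.
split; first by rewrite linear0 rpred0.
by move=> a x y fx fy; rewrite linearP rpredD ?rpredZ.
Qed.

Lemma mono_inj (C : lmodType R -> Prop) M N (f : {linear M -> N}) :
  (forall A : submodClosed M, C (submodule_of A)) -> monomorphism_in C f -> injective f.
Proof.
move=> CM mf; apply: linear_inj => x fx.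
pose A := sub_of (ker_submod f).
have xA : x \in A by apply/sub_ofP.
have := mf _ (CM A) (incl A) \0 _ (Sub x xA); apply=> y.
by have /sub_ofP fy := valP y; rewrite linear0.
Qed.

Lemma dual_basis_sub P (phi : P -> {linear P -> R^o}) : locally_finite phi ->
  (forall x s, uniq s -> (forall y, y \notin s -> phi y x = 0) ->
    x = \sum_(y <- s) (phi y x : R) *: y) ->
  forall (B : submodClosed P) x, (forall y, phi y x <> 0 -> y \in B) -> x \in B.
Proof.
move=> lf bas B x xB; have [s s0] := lf x.
rewrite (bas x (undup s)) ?undup_uniq //; last by move=> y; rewrite mem_undup => /s0.
rewrite rpred_sum // => y _.
have [->|/eqP/xB] := eqVneq (phi y x) 0; first by rewrite scale0r rpred0.
exact: rpredZ.
Qed.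

Lemma projective_separated P x : projective P ->
  (forall f : {linear P -> R^o}, f x = 0) -> x = 0.
Proof.
move=> /dual_basis[phi [_ bas]] x0.
by rewrite (bas x [::]) ?big_nil // => y _; exact: x0.
Qed.

Hypothesis hR : left_hereditary R.

Lemma regular_projective : @projective R R^o.
Proof.
apply: (@projective_locally_finite _ hR R^o unit (fun _ => idfun)).
  by move=> a; exists [:: tt] => -[].
by move=> a /(_ tt).
Qed.

(** A dual basis of [P], restricted along [i], is still locally finite and separating. *)
Lemma projective_inj A P (i : {linear A -> P}) : injective i -> projective P -> projective A.
Proof.
move=> ii /dual_basis[phi [lf bas]].
apply: (@projective_locally_finite _ hR A P (fun y => phi y \o i)).
  by move=> a; exact: lf.
move=> a a0; apply: (inj_linear0 ii).
by rewrite (bas (i a) [::]) ?big_nil // => y _; exact: a0.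
Qed.

Lemma projective_sub P (A : submodClosed P) : projective P -> projective (submodule_of A).
Proof. by apply: (@projective_inj _ _ (incl A)); exact: val_inj. Qed.

(** The image of [f] is projective, so [f] splits onto it; [e] is the resulting idempotent, with the
    same kernel as [f]. *)
Lemma kernel_split M P (f : {linear M -> P}) : projective P ->
  exists e : {linear M -> M},
    (forall x, f (e x) = f x) /\ (forall x, f x = 0 -> e x = 0).
Proof.
move=> projP; pose A := sub_of (im_submod f).
have fA x : f x \in A by apply/sub_ofP; exists x.
have [|j jP] := @projective_sub _ A projP _ _ (corestr fA) idfun.
  move=> y; have /sub_ofP[x xy] := valP y.
  by exists x; apply: val_inj.
exists (j \o corestr fA); split=> x.
  by have /(congr1 val) := jP (corestr fA x).
move=> fx; rewrite /= (_ : corestr fA x = 0) ?linear0 //.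
by apply: val_inj; rewrite /= fx.
Qed.

(** The kernel of [f] is a direct summand containing an essential submodule, so its complement is
    0. *)
Lemma essential_zero M E P (i : {linear M -> E}) (f : {linear E -> P}) :
  essential i -> projective P -> (forall x, f (i x) = 0) -> forall y, f y = 0.
Proof.
move=> ess projP fi; have [e [fe e0]] := kernel_split f projP.
have ee y : e (e y) = e y.
  apply/eqP; rewrite -subr_eq0 -linearB; apply/eqP/e0.
  by rewrite linearB fe subrr.
have zA := ess (sub_of (im_submod e)).
move=> y; suff ey0 : e y = 0 by rewrite -fe ey0 linear0.
apply: zA; last by apply/sub_ofP; exists y.
by move=> x /sub_ofP[z ez]; rewrite -ez -ee ez; apply: e0; exact: fi.
Qed.

Lemma direct_summand_proj M (A : submodClosed M) : direct_summand A ->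
  exists f : {linear M -> submodule_of A}, forall a, f (val a) = a.
Proof.
move=> [B [AB dis]].
have [|||f fP] := @graph_linear R M (submodule_of A) (fun m a => m - val a \in B).
- move=> x; have [a [b [aA bB ->]]] := AB x.
  by exists (Sub a aA); rewrite /= addrC addKr.
- move=> c x a x' a' xa xa'; rewrite [\val _](linearP (incl A)) opprD addrACA -scalerBr.
  by rewrite rpredD ?rpredZ.
- move=> a /(rpredZ (-1)); rewrite sub0r scalerN scaleN1r opprK => aB.
  by apply: val_inj; apply: dis => //; exact: valP.
by exists f => a; apply: fP; rewrite subrr rpred0.
Qed.

(** A functional splits over its image, which gives a projective summand; conversely the functionals
    of a projective summand extend to [M] by the projection and separate its elements. *)
Lemma stableP M : stable M <-> forall (f : {linear M -> R^o}) x, f x = 0.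
Proof.
split=> [stM f x|M0 A sA projA x xA].
  have [e [fe e0]] := kernel_split f regular_projective.
  have ee y : e (e y) = e y.
    apply/eqP; rewrite -subr_eq0 -linearB; apply/eqP/e0.
    by rewrite linearB fe subrr.
  suff ex0 : e x = 0 by rewrite -fe ex0 linear0.
  apply: (stM (sub_of (im_submod e))); last by apply/sub_ofP; exists x.
    exists (sub_of (ker_submod e)); split.
      move=> y; exists (e y), (y - e y); split; last by rewrite addrC subrK.
        by apply/sub_ofP; exists y.
      by apply/sub_ofP; rewrite linearB ee subrr.
    by move=> y /sub_ofP[z <-] /sub_ofP; rewrite ee.
  apply: (@projective_inj _ _ (f \o incl _)) regular_projective.
  apply: linear_inj => y /= fy; apply: val_inj.
  by have /sub_ofP[z zy] := valP y; rewrite /= -zy -ee zy e0.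
have [p pP] := direct_summand_proj sA.
suff : Sub x xA = 0 :> submodule_of A by move/(congr1 val).
apply: projective_separated => // g.
by rewrite -(pP (Sub x xA)); exact: (M0 (g \o p)).
Qed.

Lemma stable_hom_zero M P (f : {linear M -> P}) x : stable M -> projective P -> f x = 0.
Proof.
by move=> /stableP M0 projP; apply: projective_separated => // g; exact: (M0 (g \o f)).
Qed.

End Splitting.

(** * Implications resting on injectivity of [I] and essentiality of [R] in [I] *)

Section Equivalences.
Variables (R : pzRingType) (I : lmodType R) (iota : {linear R^o -> I}).
Hypotheses (hR : left_hereditary R) (hI : injective_envelope iota).
Implicit Types A M N P Q E : lmodType R.

(** The hypothesis provides some projective envelope [E]; its embedding of [R] extends to [I],
    injectively by essentiality, so [I] is a submodule of [E]. *)
Lemma QF3plus_projective : left_QF3plus R -> projective I.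
Proof.
case: hI => injI ii ess [E [i [[injE iE _] projE]]].
have [g gP] := injE _ _ iota i ii.
apply: (@projective_inj _ hR _ _ g) projE; apply: linear_inj => y gy.
apply: (ess (sub_of (ker_submod g))); last exact/sub_ofP.
move=> x /sub_ofP; rewrite gP => /(inj_linear0 iE) ->; exact: linear0.
Qed.

(** With [I] in place of [R] as test object, Hom(-, I) is exact, which makes the stable modules a
    Serre class. *)
Lemma stable_injP M : projective I -> stable M <-> forall (f : {linear M -> I}) x, f x = 0.
Proof.
case: hI => injI ii ess projI; split=> [stM f x|M0]; first exact: stable_hom_zero.
by apply/stableP => // f x; apply: (inj_linear0 ii); exact: (M0 (iota \o f)).
Qed.

Lemma serre_stable : projective I -> serre (@stable R).
Proof.
move=> projI; have stP M := stable_injP M projI.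
case: hI => injI _ _; split.
- move=> M N i ii /stP N0; apply/stP => f x.
  by have [g gP] := injI _ _ i f ii; rewrite -gP.
- move=> M N p ps /stP M0; apply/stP => f y.
  by have [x <-] := ps y; exact: (M0 (f \o p)).
- move=> M N Q i p [ii ps ex] /stP M0 /stP Q0; apply/stP => f x.
  have [|||g gP] := @graph_linear R Q I (fun q z => exists2 y, p y = q & f y = z).
  + by move=> q; have [y yq] := ps q; exists (f y), y.
  + by move=> a _ _ _ _ [y <- <-] [y' <- <-]; exists (a *: y + y'); rewrite linearP.
  + by move=> z [y /ex[u <-] <-]; exact: (M0 (f \o i)).
  by rewrite -(gP (p x) (f x)); [exact: Q0|exists x].
Qed.

Lemma localizing_stable : serre (@stable R) -> localizing (@stable R).
Proof.
move=> sst; split=> // J F D inj sumD stF; apply/(stableP hR) => f x.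
have [g [g0 gU]] := sumD R^o (fun j => \0).
have z0 : \0 =1 g by apply: gU => j y.
rewrite (gU f) -?z0 // => j y.
by have /(stableP hR) F0 := stF j; exact: (F0 (f \o inj j)).
Qed.

(** The reject of [I] in [M], the torsion part for the torsion theory cogenerated by [I]. *)
Definition hom_reject M : M -> Prop := fun x => forall f : {linear M -> I}, f x = 0.

Lemma hom_reject_submod M : is_submod (@hom_reject M).
Proof.
split=> [f|a x y hx hy f]; first exact: linear0.
by rewrite linearP hx hy scaler0 addr0.
Qed.

(** The reject is stable since its functionals extend to maps from [M] to [I]. For a stable [T] and
    [f] from [M] to [I], the part [D] of [T] sent into [R] is stable as a submodule, so [f] kills
    it; thus the image of [T] meets [R] in 0 and is 0 by essentiality. *)
Lemma largest_stable_reject : serre (@stable R) -> forall M, exists S : submodClosed M,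
  largest_stable_submodule S /\
  (forall x : M, x \in S <-> forall f : {linear M -> I}, f x = 0).
Proof.
case: hI => injI ii ess [sub _ _] M.
exists (sub_of (hom_reject_submod M)); split; last by move=> x; rewrite sub_ofP.
split=> [|T stT x xT].
  apply/stableP => // f x.
  have [g gP] := injI _ _ (incl _) (iota \o f) val_inj.
  apply: (inj_linear0 ii); rewrite -[LHS]gP /=.
  by have /sub_ofP := valP x; apply.
apply/sub_ofP => f.
pose im := sub_of (im_submod iota).
pose D := sub_of (preim_submod (f \o incl T) im).
have stD : stable (submodule_of D) by apply: sub stT; exact: (@val_inj _ _ (submodule_of D)).
have D0 (t : submodule_of T) : t \in D -> f (val t) = 0.
  move=> tD; have [|||g gP] := @graph_linear R (submodule_of D) R^o
      (fun d r => iota r = (f \o incl T \o incl D) d).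
  - by move=> d; have /sub_ofP/sub_ofP[r rd] := valP d; exists r.
  - by move=> a d r d' r' dr dr'; rewrite linearP dr dr' linearP.
  - by move=> r; rewrite linear0 => /(inj_linear0 ii).
  have /sub_ofP/sub_ofP[r rt] := tD.
  have /stableP-/(_ hR) D0 := stD.
  by move: (gP (Sub t tD) r rt); rewrite D0 => r0; rewrite /= in rt; rewrite -rt -r0 linear0.
apply: (ess (sub_of (im_submod (f \o incl T)))).
  move=> r /sub_ofP[t tr]; rewrite -tr; apply: D0.
  by apply/sub_ofP/sub_ofP; exists r.
by apply/sub_ofP; exists (Sub x xT).
Qed.

(** A functional on [A] extends to a map from [M] to [I]. This map is 0, because the stable module
    [M] is its own largest stable submodule. *)
Lemma no_projective_submodule :
  (forall M, exists S : submodClosed M, largest_stable_submodule S /\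
     (forall x : M, x \in S <-> forall f : {linear M -> I}, f x = 0)) ->
  forall M, stable M ->
    forall A : submodClosed M, projective (submodule_of A) -> zero_submodule A.
Proof.
case: hI => injI ii ess rej M stM A projA x xA.
suff : Sub x xA = 0 :> submodule_of A by move/(congr1 val).
apply: projective_separated => // g.
have [h hP] := injI _ _ (incl A) (iota \o g) val_inj.
apply: (inj_linear0 ii); rewrite -[LHS]hP /=.
have [S [[_ Smax] SP]] := rej M.
have idP : forall y : M, idfun y \in sub_of (full_submod M) by move=> y; apply/sub_ofP.
have /Smax/(_ x) : stable (submodule_of (sub_of (full_submod M))).
  apply/stableP => // f y.
  have /stableP-/(_ hR)/(_ (f \o corestr idP) (incl _ y)) := stM.
  have yE : corestr idP (incl _ y) = y by apply: incl_inj.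
  by rewrite /= yE.
by move=> /(_ (idP x))/SP; apply.
Qed.

(** The unit at [R] is injective since the identity factors through it. By naturality the unit at
    [I] is injective on [R], hence on [I], which embeds [I] in a projective module. *)
Lemma QF3plus_of_reflector (r : reflector (@projective R)) :
  monomorphism_in (@projective R) (refl_map r iota) -> left_QF3plus R.
Proof.
case: hI => injI ii ess mono; exists I, iota; split=> //.
have uR : injective (refl_unit r R^o).
  have [g [gP _]] := refl_univ r (idfun : {linear R^o -> R^o}) (regular_projective hR).
  by move=> x y xy; rewrite -[x]gP xy gP.
have mi : injective (refl_map r iota).
  by apply: mono_inj mono => A; exact: (@projective_sub _ hR _ A (refl_in r R^o)).
have ui : injective (refl_unit r I).
  apply: linear_inj => y uy; apply: (ess (sub_of (ker_submod (refl_unit r I)))).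
    move=> x /sub_ofP; rewrite -refl_natural => /(inj_linear0 mi)/(inj_linear0 uR) ->.
    exact: linear0.
  exact/sub_ofP.
exact: (projective_inj hR ui (refl_in r I)).
Qed.

End Equivalences.

(** * Products of projectives and the projective reflection *)

Lemma sum_scale_linear (R : pzRingType) (M N : lmodType R) (J : Type) (s : seq J)
  (f : J -> {linear M -> R^o}) (z : J -> N) :
  linear (fun x => \sum_(j <- s) (f j x : R) *: z j).
Proof.
move=> a x y; rewrite scaler_sumr -big_split /=; apply: eq_bigr => j _.
by rewrite linearP scalerDl scalerA.
Qed.

Lemma projective_rV (R : pzRingType) n : @projective R 'rV[R]_n.
Proof.
move=> M N p f ps.
have /choice[m mP] : forall i, exists m, p m = f (delta_mx 0 i) by move=> i; exact: ps.
have gl : linear (fun v : 'rV[R]_n => \sum_i v 0 i *: m i).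
  move=> a u v; rewrite scaler_sumr -big_split /=; apply: eq_bigr => i _.
  by rewrite !mxE scalerDl scalerA.
exists (lin_of gl) => v; rewrite lin_ofE [v in RHS]row_sum_delta !linear_sum.
by apply: eq_bigr => i _; rewrite !linearZ /= mP.
Qed.

(** Coherence presents the right ideal generated by [r] on other generators; comparing the two free
    covers as in Schanuel's lemma gives finitely many generating relations for [r] itself, the
    columns of [c]. *)
Lemma right_coherent_relations (R : pzRingType) n (r : 'I_n -> R) : right_coherent R ->
  exists m (c : 'I_n -> 'I_m -> R), (forall l, \sum_i r i * c i l = 0) /\
    forall s : 'I_n -> R, \sum_i r i * s i = 0 ->
    exists t : 'I_m -> R, forall i, s i = \sum_l c i l * t l.
Proof.
move=> coh.
have ql : linear (fun v : 'rV[R^c]_n => (\sum_i r i * (v 0 i : R) : R) : R^c^o).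
  move=> a u v; rewrite scaler_sumr -big_split /=; apply: eq_bigr => i _.
  by rewrite !mxE mulrDr; congr (_ + _); rewrite mulrA.
pose q := lin_of ql; pose L := sub_of (im_submod q).
have qL v : q v \in L by apply/sub_ofP; exists v.
have qs : surjective (corestr qL).
  by move=> y; have /sub_ofP[x xy] := valP y; exists x; apply: incl_inj.
have [|m [n' [g [f [fs fg]]]]] := coh L; first by exists n, (corestr qL).
have [alpha alphaP] := projective_rV (corestr qL) fs.
have [beta betaP] := projective_rV f qs.
(* The value [v - beta (alpha v) + beta (g w)] is always a relation; if [v] is one, then
   [alpha v = g w] for some [w] and the value is [v]. *)
pose h : {linear 'rV[R^c]_(n + m) -> 'rV[R^c]_n} :=
  ((lsubmx \- (beta \o alpha \o lsubmx)) \+ (beta \o g \o rsubmx)).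
have q0 v : corestr qL v = 0 <-> \sum_i r i * (v 0 i : R) = 0.
  by split=> [/(congr1 val)|v0]; [|apply: incl_inj].
have qh u : corestr qL (h u) = 0.
  rewrite /h /= linearD linearB /= !betaP alphaP subrr add0r.
  by apply/fg; exists (rsubmx u).
pose C := lin1_mx h.
exists (n + m)%N, (fun i l => C l i : R); split=> [l|s s0].
  have /q0 := qh (delta_mx 0 l); rewrite -mul_rV_lin1 -rowE.
  by under eq_bigr do rewrite mxE.
pose v : 'rV[R^c]_n := \row_i (s i : R^c).
have /fg[w gw] : f (alpha v) = 0.
  by rewrite alphaP; apply/q0; under eq_bigr do rewrite mxE.
exists (fun l => row_mx v w 0 l) => i.
have hv : h (row_mx v w) = v.
  by rewrite /h /= row_mxKl row_mxKr gw subrK.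
have /(congr1 (fun u : 'rV_n => u 0 i)) := mul_rV_lin1 h (row_mx v w).
by rewrite hv !mxE => <-.
Qed.

Section PerfectCoherent.
Variable R : pzRingType.
Hypotheses (hR : left_hereditary R) (perf : left_perfect R) (coh : right_coherent R).
Implicit Types D M N P Q E : lmodType R.

Lemma ev_linear (X : Type) (x : X) : linear (fun u : X -> R^o => u x).
Proof. by []. Qed.

Definition ev (X : Type) (x : X) : {linear (X -> R^o) -> R^o} := lin_of (@ev_linear X x).

(* A product of copies of [R] is flat, so every element of the kernel of its
   projective cover is fixed by an endomorphism [theta] of [P] with values in the
   kernel; [1 - theta] is then a split epimorphism with superfluous kernel. *)
Lemma projective_power (X : Type) : @projective R (X -> R^o).
Proof.
have [P [p [projP ps sup]]] := perf (X -> R^o).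
have p0 k : p k = 0 -> k = 0.
  move=> pk; have [phi [lf bas]] := dual_basis projP.
  have [s' s'0] := lf k; pose s := undup s'.
  have s0 y : y \notin s -> phi y k = 0 by rewrite mem_undup; exact: s'0.
  have kE := bas k s (undup_uniq _) s0.
  pose y (i : 'I_(size s)) := tnth (in_tuple s) i.
  have sumE (V : zmodType) (F : P -> V) : \sum_(z <- s) F z = \sum_i F (y i).
    exact: big_tnth.
  pose r i : R := phi (y i) k.
  have [m [c [rc cP]]] := right_coherent_relations r coh.
  (* At each point [x], [p k = 0] gives a relation among the [r i], hence coefficients [t]; as
     functions of [x] they belong to the power and lift to elements [u] of [P]. *)
  have /choice[t tP] : forall x, exists t : 'I_m -> R,
      forall i, (p (y i) x : R) = \sum_l c i l * t l.
    move=> x; apply: cP; have : (ev x \o p) k = 0 by rewrite /= pk.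
    rewrite [in X in X -> _]kE sumE linear_sum => k0; rewrite -[RHS]k0.
    by apply: eq_bigr => i _; rewrite linearZ.
  have /choice[u uP] : forall l, exists u, p u = (fun x => t x l : R^o) by move=> l; exact: ps.
  pose z i := y i - \sum_l c i l *: u l.
  have pz i : p (z i) = 0.
    apply/funext => x; rewrite -[LHS]/((ev x \o p) (z i)) /z linearB linear_sum.
    apply/eqP; rewrite subr_eq0 /=; apply/eqP; rewrite [LHS]tP.
    by apply: eq_bigr => l _; rewrite linearZ /= uP.
  pose theta := lin_of (sum_scale_linear (index_enum 'I_(size s)) (fun i => phi (y i)) z).
  have thE x : theta x = \sum_i (phi (y i) x : R) *: z i by [].
  have pth x : p (theta x) = 0.
    by rewrite thE linear_sum big1 // => i _; rewrite linearZ /= pz scaler0.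
  have thk : theta k = k.
    rewrite thE [RHS]kE sumE /z; under eq_bigr do rewrite scalerBr.
    rewrite sumrB; apply/eqP; rewrite subr_eq addrC -subr_eq subrr; apply/eqP.
    under eq_bigr do rewrite scaler_sumr; rewrite exchange_big big1 //= => l _.
    by under eq_bigr do rewrite scalerA; rewrite -scaler_suml rc scale0r.
  have Ds : surjective (idfun \- theta : {linear P -> P}).
    move=> x.
    suff : x \in sub_of (im_submod (idfun \- theta : {linear P -> P})) by move/sub_ofP.
    apply: sup => w; exists (theta w), (w - theta w).
    split; [exact: pth|by apply/sub_ofP; exists w|by rewrite addrC subrK].
  have [j jP] := projP _ _ _ idfun Ds.
  have jA w : w \in sub_of (im_submod j).
    apply: sup => {}w; exists (w - j (w - theta w)), (j (w - theta w)).
    split; [|by apply/sub_ofP; exists (w - theta w)|by rewrite subrK].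
    have /= := jP (w - theta w).
    move=> /eqP; rewrite subr_eq => /eqP jE.
    by rewrite linearB jE linearD linearB !pth subr0 addr0 subrr.
  have /sub_ofP[w wk] := jA k.
  have /= := jP w; rewrite wk thk subrr => w0.
  by rewrite -wk -w0 linear0.
have [||//|h hP] := @graph_linear R (X -> R^o) P (fun u x => p x = u).
- exact: ps.
- by move=> a u x u' x' <- <-; rewrite linearP.
apply: (@projective_inj _ hR _ _ h) projP; apply: linear_inj => u hu.
by have [x xu] := ps u; rewrite -xu -(hP _ _ xu) hu linear0.
Qed.

End PerfectCoherent.

(** * The projective reflection *)

Section Reflector.
Variable R : pzRingType.
Hypothesis hR : left_hereditary R.
Hypothesis projective_power : forall X : Type, @projective R (X -> R^o).
Implicit Types D M N P Q E : lmodType R.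

Lemma bidual_linear M : linear (fun (x : M) (f : {linear M -> R^o}) => f x).
Proof. by move=> a x y; apply/funext => f; rewrite linearP. Qed.

Definition bidual M : {linear M -> ({linear M -> R^o} -> R^o)} := lin_of (@bidual_linear M).

Definition refl_im M : submodClosed ({linear M -> R^o} -> R^o) := sub_of (im_submod (@bidual M)).

Definition torsionless_quotient M : lmodType R := submodule_of (refl_im M).

Lemma bidual_im M (x : M) : bidual M x \in refl_im M.
Proof. by apply/sub_ofP; exists x. Qed.

Definition tq_unit M : {linear M -> torsionless_quotient M} := corestr (@bidual_im M).

Lemma tq_unit_surj M : surjective (tq_unit M).
Proof. by move=> u; have /sub_ofP[x xu] := valP u; exists x; apply: incl_inj. Qed.

Lemma tq_unit0 M (x : M) : tq_unit M x = 0 <-> forall f : {linear M -> R^o}, f x = 0.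
Proof.
split=> [/(congr1 val) /= x0 f|x0]; first exact: (congr1 (fun u => u f) x0).
by apply: incl_inj; apply/funext => f; exact: x0.
Qed.

Lemma torsionless_quotient_projective M : projective (torsionless_quotient M).
Proof. exact: (@projective_sub _ hR _ (refl_im M) (@projective_power _)). Qed.

Lemma tq_univ M Q (f : {linear M -> Q}) : projective Q ->
  exists g : {linear torsionless_quotient M -> Q}, (forall x, g (tq_unit M x) = f x) /\
    (forall h : {linear torsionless_quotient M -> Q},
       (forall x, h (tq_unit M x) = f x) -> h =1 g).
Proof.
move=> projQ.
have [|||g gP] := @graph_linear R (torsionless_quotient M) Q
    (fun u q => exists2 x, tq_unit M x = u & f x = q).
- by move=> u; have [x xu] := tq_unit_surj u; exists (f x), x.
- by move=> a _ _ _ _ [x <- <-] [y <- <-]; exists (a *: x + y); rewrite linearP.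
- move=> q [x /tq_unit0 x0 <-]; apply: projective_separated => // h.
  exact: (x0 (h \o f)).
exists g; split=> [x|h hP u]; first by apply: gP; exists x.
by have [x <-] := tq_unit_surj u; rewrite hP (gP _ (f x)) //; exists x.
Qed.

Lemma projective_reflector : exists r : reflector (@projective R),
  forall M, surjective (refl_unit r M) /\
    forall x : M, refl_unit r M x = 0 <-> forall f : {linear M -> R^o}, f x = 0.
Proof.
have map M N (f : {linear M -> N}) :
    {g : {linear torsionless_quotient M -> torsionless_quotient N} |
      forall x, g (tq_unit M x) = tq_unit N (f x)}.
  apply: cid.
  have [g [gP _]] := tq_univ (tq_unit N \o f) (@torsionless_quotient_projective N).
  by exists g.
exists (@Reflector R (@projective R) torsionless_quotient
  (@torsionless_quotient_projective)
  (fun M N f => sval (map M N f)) tq_unit (fun M N f => svalP (map M N f)) (@tq_univ)).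
by split; [exact: tq_unit_surj|exact: tq_unit0].
Qed.

(** A functional on [D] splits over its image, and the projective summand obtained embeds in the
    stable module [M], so it is 0. *)
Lemma stable_sub_of_no_projective M D (i : {linear D -> M}) :
  (forall M, stable M -> forall A : submodClosed M,
     projective (submodule_of A) -> zero_submodule A) ->
  injective i -> stable M -> stable D.
Proof.
move=> nop ii stM; apply/stableP => // h x.
have [e [he e0]] := kernel_split hR h (regular_projective hR).
pose B := sub_of (im_submod (i \o e)).
have [|||g gP] := @graph_linear R (submodule_of B) R^o
    (fun b r => exists2 d, i (e d) = incl B b & h d = r).
- by move=> b; have /sub_ofP[d db] := valP b; exists (h d), d.
- by move=> a b _ b' _ [d db <-] [d' db' <-]; exists (a *: d + d'); rewrite !linearP ?db ?db'.
- by move=> r [d]; rewrite linear0 => /(inj_linear0 ii) ed <-; rewrite -he ed linear0.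
have gi : injective g.
  apply: linear_inj => b gb; have /sub_ofP[d db] := valP b.
  have hd : h d = 0 by rewrite -gb; apply/esym/gP; exists d.
  by apply: incl_inj; rewrite linear0 -[LHS]db /= e0 // linear0.
have B0 := nop _ stM B (projective_inj hR gi (regular_projective hR)).
rewrite -he [e x](inj_linear0 ii) ?linear0 //.
by apply: B0; apply/sub_ofP; exists x.
Qed.

(** The kernel [K] of the unit of [N] is a summand, so its functionals extend to [N] and vanish on
    [K]: it is stable. Its preimage [D] in [M] embeds in [K], hence is stable and lies in the kernel
    of the unit of [M]. *)
Lemma reflector_preserves_mono :
  (forall M, stable M -> forall A : submodClosed M,
     projective (submodule_of A) -> zero_submodule A) ->
  exists r : reflector (@projective R), preserves_monomorphisms r.
Proof.
move=> nop; have [r r0] := projective_reflector; exists r => M N f mf.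
have fi : injective f by exact: mono_inj mf.
suff ri : injective (refl_map r f) by move=> Q _ g h gh x; apply: ri.
apply: linear_inj => u ru.
have [[us u0] [_ v0]] := (r0 M, r0 N).
have [x xu] := us u; rewrite -xu; apply/u0 => h.
pose K := sub_of (ker_submod (refl_unit r N)).
have stK : stable (submodule_of K).
  apply/stableP => // f' k.
  have [e [eu e0]] := kernel_split hR (refl_unit r N) (refl_in r N).
  have eK y : (idfun \- e : {linear N -> N}) y \in K.
    by apply/sub_ofP; rewrite linearB eu subrr.
  have /sub_ofP uk := valP k.
  have := (v0 _).1 uk (f' \o corestr eK); rewrite /=.
  suff -> : corestr eK (incl K k) = k by [].
  by apply: incl_inj; rewrite /= e0 // subr0.
pose D := sub_of (preim_submod f K).
have DK (d : submodule_of D) : (f \o incl D) d \in K by have /sub_ofP := valP d.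
have stD : stable (submodule_of D).
  apply: (stable_sub_of_no_projective (i := corestr DK)) stK => //.
  by move=> d d' /(congr1 val) /= /fi; exact: incl_inj.
have xD : x \in D.
  by apply/sub_ofP/sub_ofP; rewrite -refl_natural xu.
have /(stableP hR) D0 := stD.
exact: (D0 (h \o incl D) (Sub x xD)).
Qed.

End Reflector.

(** * The injective envelope is noetherian *)

Section Noetherian.
Variable R : pzRingType.
Implicit Types D M N P Q E : lmodType R.

Definition generated_by M (s : seq M) (A : M -> Prop) : Prop :=
  (forall x, x \in s -> A x) /\
  (forall B : submodClosed M, (forall x, x \in s -> x \in B) -> forall x, A x -> x \in B).

Definition noetherian M : Prop :=
  forall A : submodClosed M, exists s, generated_by s (fun x => x \in A).

Lemma span_submod M (s : seq M) : is_submod (fun y =>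
  forall B : submodClosed M, (forall x, x \in s -> x \in B) -> y \in B).
Proof.
split=> [B _|a x y hx hy B sB]; first exact: rpred0.
by rewrite rpredD ?rpredZ ?hx ?hy.
Qed.

Definition span M (s : seq M) : submodClosed M := sub_of (span_submod s).

Lemma mem_span M (s : seq M) x : x \in s -> x \in span s.
Proof. by move=> xs; apply/sub_ofP => B; apply. Qed.

Lemma span_sub M (s : seq M) (B : submodClosed M) :
  (forall x, x \in s -> x \in B) -> forall x, x \in span s -> x \in B.
Proof. by move=> sB x /sub_ofP; apply. Qed.

Lemma noetherian_inj M N (f : {linear M -> N}) : injective f -> noetherian N -> noetherian M.
Proof.
move=> fi noeN A.
have [s [sA Amin]] := noeN (sub_of (im_submod (f \o incl A))).
have [t [tA ts]] : exists t : seq M, (forall x, x \in t -> x \in A) /\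
    forall y, y \in s -> exists2 x, x \in t & f x = y.
  elim: s sA {Amin} => [|y s IH] sA; first by exists [::].
  have [|t [tA ts]] := IH; first by move=> z zs; apply: sA; rewrite inE zs orbT.
  have /sub_ofP[a ay] : y \in sub_of (im_submod (f \o incl A)) by apply: sA; rewrite inE eqxx.
  exists (val a :: t); split=> [x|z].
    by rewrite inE => /orP[/eqP->|/tA //]; exact: valP.
  rewrite inE => /orP[/eqP->|/ts[x xt xz]]; first by exists (val a); rewrite ?inE ?eqxx.
  by exists x => //; rewrite inE xt orbT.
exists t; split=> // B tB x xA.
have /sub_ofP[b /fi <-] : f x \in sub_of (im_submod (f \o incl B)).
  apply: Amin; last by apply/sub_ofP; exists (Sub x xA).
  by move=> y /ts[z zt <-]; apply/sub_ofP; exists (Sub z (tB z zt)).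
exact: valP.
Qed.

(** [C] is maximal among the submodules meeting [B] in 0. The second clause is essentiality of
    [B + C]: a [D] meeting it in 0 could be added to [C]. *)
Lemma complement_exists M (B : submodClosed M) : exists C : submodClosed M,
  (forall x, x \in B -> x \in C -> x = 0) /\
  (forall D : submodClosed M, (forall b c, b \in B -> c \in C -> b + c \in D -> b + c = 0) ->
     zero_submodule D).
Proof.
have [|F [X0 FX0] FP Ft|C [[Cs BC] _ Cmax]] := @zorn_above M
    (fun C => is_submod C /\ forall x, x \in B -> C x -> x = 0) (fun x => x = 0).
- by split=> //; split=> // a x y -> ->; rewrite scaler0 addr0.
- split; last by move=> x xB [X FX]; have [_] := FP _ FX; exact.
  split; first by exists X0 => //; have [[]] := FP _ FX0.
  move=> a x y [X FX Xx] [Y FY Yy].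
  have [/(_ _ Xx) Yx|/(_ _ Yy) Xy] := Ft _ _ FX FY.
    by exists Y => //; have [[_ Yl] _] := FP _ FY; apply: Yl.
  by exists X => //; have [[_ Xl] _] := FP _ FX; apply: Xl.
exists (sub_of Cs); split=> [x xB /sub_ofP|D D0]; first exact: BC.
have DC d : d \in D -> C d.
  move=> dD; apply: (Cmax (fun x => exists c d, [/\ C c, d \in D & x = c + d])).
  - by move=> x Cx; exists x, 0; rewrite rpred0 addr0.
  - split.
      split; first by exists 0, 0; rewrite rpred0 addr0; split=> //; exact: Cs.1.
      move=> a _ _ [c [e [Cc eD ->]]] [c' [e' [Cc' e'D ->]]].
      exists (a *: c + c'), (a *: e + e'); split; last by rewrite scalerDr addrACA.
        exact: Cs.2.
      by rewrite rpredD ?rpredZ.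
    move=> x xB [c [e [Cc eD xE]]].
    have : e = 0.
      suff -> : e = x - c.
        apply: D0 => //; last by rewrite xE addrC addKr.
        by apply/sub_ofP; rewrite -scaleN1r -[_ *: _]addr0; apply: Cs.2 => //; exact: Cs.1.
      by rewrite xE addrC addKr.
    by move: xE => /[swap] ->; rewrite addr0 => xc; apply: BC xB _; rewrite xc.
  - by exists 0, d; rewrite add0r; split=> //; exact: Cs.1.
move=> x xD; rewrite -[x]add0r; apply: D0; rewrite ?rpred0 ?add0r //.
exact/sub_ofP/DC.
Qed.

Lemma locally_finite_seq M (X : eqType) (phi : X -> {linear M -> R^o}) (s : seq M) :
  locally_finite phi -> exists t : seq X, forall y, y \notin t -> forall x, x \in s -> phi y x = 0.
Proof.
move=> lf; elim: s => [|x s [t tP]]; first by exists [::].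
have [t' t'P] := lf x; exists (t ++ t') => y; rewrite mem_cat negb_or => /andP[yt yt'] z.
by rewrite inE => /orP[/eqP->|]; [exact: t'P|exact: tP].
Qed.

Hypothesis hR : left_hereditary R.

(** Dual basis functionals vanishing on [s] vanish on [P] by essentiality; finitely many remain, and
    their basis elements generate [P]. *)
Lemma essential_span_generated P (s : seq P) : projective P ->
  essential (incl (span s)) -> exists t : seq P, generated_by t (fun _ => True).
Proof.
move=> projP ess; have [phi [lf bas]] := dual_basis projP.
have [t tP] := locally_finite_seq s lf.
have phi0 y : y \notin t -> forall x, phi y x = 0.
  move=> yt; apply: (essential_zero hR ess (regular_projective hR)) => x.
  suff /sub_ofP : val x \in sub_of (ker_submod (phi y)) by [].
  apply: span_sub (valP x) => z zs; apply/sub_ofP; exact: tP.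
exists t; split=> // B tB x _; apply: (dual_basis_sub lf bas) => y phiy.
by apply: tB; apply: contrapT => /negP /phi0.
Qed.

Section InjectiveProjective.
Variable I : lmodType R.
Hypotheses (injI : injective_module I) (projI : projective I).
Variable gens : seq I.
Hypothesis gensP : generated_by gens (fun _ => True).

(** Since maps to a projective are determined on an essential submodule, this is the injective hull
    inside [I] of the span of [S]. *)
Definition hom_closure (S : I -> Prop) (x : I) : Prop :=
  forall h : {linear I -> I}, (forall y, S y -> h y = 0) -> h x = 0.

Lemma hom_closure_submod S : is_submod (hom_closure S).
Proof.
split=> [h _|a x y hx hy h hS]; first exact: linear0.
by rewrite linearP hx // hy // scaler0 addr0.
Qed.

(* The retraction of [I] onto the closure comes from extending the projection of
   closure + complement, an essential submodule, along injectivity. *)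
Lemma hom_closure_generated S : exists s, generated_by s (hom_closure S).
Proof.
pose B := sub_of (hom_closure_submod S).
have [C [BC ess]] := complement_exists B.
have [|||g gP] := @injective_extend_graph R I I
    (fun x y => y \in B /\ x - y \in C) injI.
- by rewrite subr0 !rpred0.
- move=> a x y x' y' [yB xy] [y'B xy'].
  split; first by rewrite rpredD ?rpredZ.
  by rewrite opprD addrACA -scalerBr rpredD ?rpredZ.
- move=> y [yB]; rewrite sub0r => /(rpredZ (-1)); rewrite scaleN1r opprK.
  exact: BC.
have gB x : g x \in B.
  apply/sub_ofP => h hS.
  have BCs : is_submod (fun x => exists b c, [/\ b \in B, c \in C & x = b + c]).
    split; first by exists 0, 0; rewrite !rpred0 addr0.
    move=> a _ _ [b [c [bB cC ->]]] [b' [c' [b'B c'C ->]]].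
    exists (a *: b + b'), (a *: c + c'); split; last by rewrite scalerDr addrACA.
      by rewrite rpredD ?rpredZ.
    by rewrite rpredD ?rpredZ.
  apply: (@essential_zero _ hR _ _ _ (incl (sub_of BCs)) (h \o g)) => //.
    move=> A A0; apply: ess => b c bB cC bcA.
    have bcS : b + c \in sub_of BCs by apply/sub_ofP; exists b, c.
    exact: (A0 (Sub (b + c) bcS)).
  move=> z; have /sub_ofP[b [c [bB cC zE]]] := valP z.
  rewrite /= /incl /= zE (gP (b + c) b); last by rewrite addrC addKr.
  by have /sub_ofP := bB; apply.
exists (map g gens); split.
  by move=> x /mapP[y _ ->]; exact: (sub_ofP (hom_closure_submod S) (g y)).1 (gB y).
move=> A gA x xB.
have <- : g x = x by apply: gP; rewrite subrr rpred0; split=> //; exact/sub_ofP.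
apply/(sub_ofP (preim_submod g A)); apply: gensP.2 => // y yg.
by apply/sub_ofP/gA/map_f.
Qed.


(** It follows that [x i] lies outside the [hom_closure] of the other members. *)
Definition coordinate_independent (X : Type) (x : X -> I) : Prop :=
  forall i, exists h : {linear I -> I}, h (x i) <> 0 /\ forall j, j <> i -> h (x j) = 0.

Section Diagonal.
Variable x : nat * nat -> I.
Hypothesis xind : coordinate_independent x.

Let below (f : nat -> nat) (y : I) : Prop := exists a b, (b <= f a)%N /\ y = x (a, b).
Let E f := hom_closure (below f).

Let x_in a b f : (b <= f a)%N -> E f (x (a, b)).
Proof. by move=> bf h; apply; exists a, b. Qed.

Let x_notin a b f : E f (x (a, b)) -> (b <= f a)%N.
Proof.
have [h [hab h0]] := xind (a, b) => /(_ h) hE.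
apply: contrapT => nb; apply/hab/hE => _ [a' [b' [b'f ->]]].
by apply: h0 => -[? ?]; subst.
Qed.

Let E_mono f g y : (forall a, (f a <= g a)%N) -> E f y -> E g y.
Proof.
move=> fg Efy h hg; apply: Efy => _ [a [b [bf ->]]].
by apply: hg; exists a, b; split=> //; exact: leq_trans (fg a).
Qed.

Let union_submod : is_submod (fun y => exists f, E f y).
Proof.
split; first by exists (fun _ => 0%N) => h _; exact: linear0.
move=> a y z [f Ef] [g Eg]; exists (fun a => maxn (f a) (g a)).
apply: (hom_closure_submod (below (fun a => maxn (f a) (g a)))).2.
  by apply: E_mono Ef => b; exact: leq_maxl.
by apply: E_mono Eg => b; exact: leq_maxr.
Qed.

(* The union [L] of the finitely generated modules [E f] over all [f : nat -> nat]
   cannot be projective: iterating the finite supports of a dual basis gives a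
   countable family [fs] whose diagonal is not captured by any [E (fs n)]. *)
Lemma diagonal_contradiction : False.
Proof.
pose L := sub_of union_submod.
have [phi [lf bas]] := dual_basis (@projective_sub _ hR _ L projI).
have ex_Y f : exists Y : seq (submodule_of L),
    forall z : submodule_of L, E f (val z) -> forall y, y \notin Y -> phi y z = 0.
  have [s [sE smin]] := hom_closure_generated (below f).
  have [t ts] : exists t : seq (submodule_of L), map val t = s.
    elim: s sE {smin} => [|y s IH] sE; first by exists [::].
    have [|t <-] := IH; first by move=> z zs; apply: sE; rewrite inE zs orbT.
    have yL : y \in L by apply/sub_ofP; exists f; apply: sE; rewrite inE eqxx.
    by exists (Sub y yL :: t).
  have [Y YP] := locally_finite_seq t lf; exists Y => z Ez y yY.
  have : incl L z \in sub_of (im_submod (incl L \o incl (sub_of (ker_submod (phi y))))).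
    apply: smin => // w; rewrite -ts => /mapP[u ut ->]; apply/sub_ofP.
    have uK : u \in sub_of (ker_submod (phi y)) by apply/sub_ofP; exact: YP.
    by exists (Sub u uK).
  by move=> /sub_ofP[u /incl_inj <-]; have /sub_ofP := valP u.
have /choice[Y YP] := ex_Y.
have ex_F f : exists F, forall y, y \in Y f -> E F (val y).
  elim: (Y f) => [|y s [F FP]]; first by exists f.
  have /sub_ofP[G EG] := valP y; exists (fun a => maxn (F a) (G a)) => z.
  rewrite inE => /orP[/eqP->|/FP Ez].
    by apply: E_mono EG => a; exact: leq_maxr.
  by apply: E_mono Ez => a; exact: leq_maxl.
have /choice[F FP] := ex_F.
(* Dominating [F] of the previous function keeps the dual basis elements met by one [E] inside the
   next; the successor makes the growth strict for the final contradiction. *)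
pose fs := fix fs n := if n is n'.+1 then
  (fun k => maxn (F (fs n') k) (fs n' k).+1) else (fun _ => 0%N).
have fsS n k : fs n.+1 k = maxn (F (fs n) k) (fs n k).+1 by [].
have fs_mono m n k : (m <= n)%N -> (fs m k <= fs n k)%N.
  elim: n => [|n IH]; first by rewrite leqn0 => /eqP->.
  rewrite leq_eqVlt => /orP[/eqP-> //|]; rewrite ltnS => /IH mn.
  by apply: leq_trans mn _; rewrite fsS leq_max leqnSn orbT.
pose g n := fs n.+1 n.
have [K KP] : exists K, forall y, y \in Y g -> (exists m, y \in Y (fs m)) -> E (fs K) (val y).
  elim: (Y g) => [|y s [K KP]]; first by exists 0%N.
  have [[m ym]|nm] := pselect (exists m, y \in Y (fs m)); last first.
    by exists K => z; rewrite inE => /orP[/eqP-> /nm|/KP].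
  exists (maxn K m.+1) => z; rewrite inE => /orP[/eqP-> _|zs zm].
    apply: E_mono (FP _ _ ym) => k; apply: leq_trans (fs_mono _ _ _ (leq_maxr _ _)).
    by rewrite fsS leq_maxl.
  by apply: E_mono (KP _ zs zm) => k; exact/fs_mono/leq_maxl.
have zL : x (K, g K) \in L by apply/sub_ofP; exists g; exact: x_in.
pose z : submodule_of L := Sub (x (K, g K)) zL.
(* This element lies in [E g] and, as [g K = fs K.+1 K], in [E (fs K.+1)]. Its nonzero coordinates
   have indices in both [Y g] and [Y (fs K.+1)], hence in [E (fs K)] by the choice of [K]; so the
   element is there too, forcing [g K <= fs K K]. *)
have : z \in sub_of (preim_submod (incl L) (sub_of (hom_closure_submod (below (fs K))))).
  apply: (dual_basis_sub lf bas) => y phiy; apply/sub_ofP/sub_ofP; apply: KP.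
    by apply: contrapT => /negP yY; apply: phiy; apply: YP yY; exact: x_in.
  exists K.+1; apply: contrapT => /negP yY; apply: phiy; apply: YP yY.
  exact: x_in.
move=> /sub_ofP/sub_ofP/x_notin; rewrite /g fsS leqNgt.
by rewrite leq_max leqnn orbT.
Qed.

End Diagonal.

Section Independent.
Variable x : nat -> I.
Hypothesis xspan : forall n a, a *: x n \in span (map x (iota 0 n)) -> a *: x n = 0.
Hypothesis x_neq0 : forall n, x n <> 0.

Let sum_zero n (a : nat -> R) : \sum_(0 <= j < n) a j *: x j = 0 ->
  forall j, (j < n)%N -> a j *: x j = 0.
Proof.
elim: n => // n IH; rewrite big_nat_recr //= => /eqP.
rewrite addrC addr_eq0 => /eqP an.
have an0 : a n *: x n = 0.
  apply: xspan; rewrite an -scaleN1r rpredZ // big_seq rpred_sum // => j.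
  rewrite mem_index_iota => jn; rewrite rpredZ // mem_span // map_f //.
  by rewrite mem_iota.
move=> j; rewrite ltnS leq_eqVlt => /orP[/eqP-> //|]; apply: IH.
by apply/eqP; rewrite -oppr_eq0 -an an0.
Qed.

(** Independence makes the projection of the span to the [i]-th term well defined, and injectivity
    of [I] extends it to an endomorphism. *)
Lemma independent_coordinate : coordinate_independent x.
Proof.
move=> i.
have [|||h hP] := @injective_extend_graph R I I (fun w y => exists n (a : nat -> R),
    [/\ forall j, (n <= j)%N -> a j = 0, w = \sum_(0 <= j < n) a j *: x j & y = a i *: x i]) injI.
- exists 0%N, (fun _ => 0); split=> //; first by rewrite big_geq.
  by rewrite scale0r.
- move=> c _ _ _ _ [n [a [an -> ->]]] [m [b [bm -> ->]]].
  have ext k (d : nat -> R) p : (forall j, (k <= j)%N -> d j = 0) -> (k <= p)%N ->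
      \sum_(0 <= j < k) d j *: x j = \sum_(0 <= j < p) d j *: x j.
    move=> dk kp; rewrite [RHS](big_cat_nat (leq0n k) kp) /= [X in _ + X]big_nat_cond.
    by rewrite [X in _ + X]big1 ?addr0 // => j /andP[/andP[/dk-> _] _]; rewrite scale0r.
  exists (maxn n m), (fun j => c * a j + b j); split.
  + by move=> j; rewrite geq_max => /andP[/an-> /bm->]; rewrite mulr0 addr0.
  + rewrite (ext _ _ _ an (leq_maxl n m)) (ext _ _ _ bm (leq_maxr n m)).
    rewrite scaler_sumr -big_split; apply: eq_bigr => j _.
    by rewrite scalerA scalerDl.
  + by rewrite scalerA scalerDl.
- move=> y [n [a [an /esym/sum_zero a0 ->]]].
  by have [/an->|/a0 //] := leqP n i; rewrite scale0r.
have hx j : h (x j) = (j == i)%:R *: x i.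
  apply: hP; exists j.+1, (fun k => (j == k)%:R); split=> //.
    by move=> k jk; rewrite ltn_eqF.
  rewrite big_nat_recr //= eqxx scale1r big_nat_cond big1 ?add0r // => k /andP[/andP[_ kj] _].
  by rewrite gtn_eqF // scale0r.
exists h; split; first by rewrite hx eqxx scale1r.
by move=> j /eqP/negbTE ji; rewrite hx ji scale0r.
Qed.

End Independent.

(** If [A] is not finitely generated, none of its finitely generated submodules is essential in it,
    so every finite list in [A] has an independent continuation. The resulting sequence is reindexed
    by pairs through [pickle]. *)
Lemma injective_projective_noetherian : noetherian I.
Proof.
move=> A; apply: contrapT => nfg.
have step (s : seq I) : exists y, (forall z, z \in s -> z \in A) ->
    [/\ y \in A, y <> 0 & forall a, a *: y \in span s -> a *: y = 0].
  (* The default 0 for lists outside [A] makes the choice function total. *)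
  have [sA|nsA] := pselect (forall z, z \in s -> z \in A); last by exists 0.
  apply: contrapT => /forallNP ny; apply: nfg.
  have [t tv] : exists t : seq (submodule_of A), map val t = s.
    elim: s sA {ny} => [|y s IH] sA; first by exists [::].
    have [|t <-] := IH; first by move=> z zs; apply: sA; rewrite inE zs orbT.
    by exists (Sub y (sA y (mem_head _ _)) :: t).
  have [|u [_ umin]] := @essential_span_generated _ t (@projective_sub _ hR _ A projI).
    move=> D D0 d dD; apply: contrapT => d0.
    apply: (ny (val d)) => _; split; [exact: valP|by move=> d0'; apply: d0; apply: incl_inj|].
    move=> a; rewrite -tv => /(span_sub (B := sub_of (im_submod (incl A \o incl (span t))))) ad.
    have /sub_ofP[w wE] : a *: val d \in sub_of (im_submod (incl A \o incl (span t))).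
      apply: ad => z /mapP[v vt ->]; apply/sub_ofP.
      by exists (Sub v (mem_span vt)).
    have {}wE : val w = a *: d by apply: incl_inj; rewrite linearZ; exact: wE.
    have := D0 w; rewrite /incl /= wE => D0w.
    have adD : a *: d \in D by rewrite rpredZ.
    by have /(congr1 val) := D0w adD.
  exists (map val u); split; first by move=> z /mapP[v _ ->]; exact: valP.
  move=> B uB z zA.
  have /sub_ofP : Sub z zA \in sub_of (preim_submod (incl A) B).
    by apply: umin => // v vu; apply/sub_ofP/uB/map_f.
  by [].
have /choice[nxt nxtP] := step.
pose xs := fix xs n := if n is n'.+1 then rcons (xs n') (nxt (xs n')) else [::].
pose x n := nxt (xs n).
have xsE n : xs n = map x (iota 0 n).
  by elim: n => // n IH; rewrite -[n.+1]addn1 iotaD map_cat -IH addn1 /= cats1.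
have xsA n : forall z, z \in xs n -> z \in A.
  elim: n => // n IH z; rewrite /= mem_rcons inE => /orP[/eqP->|/IH //].
  by have [] := nxtP _ IH.
have xind : coordinate_independent x.
  apply: independent_coordinate => n; last by have [] := nxtP _ (xsA n).
  by rewrite -xsE; have [_ _] := nxtP _ (xsA n); apply.
apply: (@diagonal_contradiction (x \o pickle)) => i.
have [h [hi hj]] := xind (pickle i); exists h; split=> // j ji; apply: hj => pij.
by apply: ji; exact: pcan_inj pickleK _ _ pij.
Qed.

End InjectiveProjective.
End Noetherian.

(** * Noetherian hereditary rings *)

Section NoetherianRing.
Variable R : pzRingType.
Implicit Types D M N P Q E : lmodType R.

Lemma noetherian_maximal M (F : submodClosed M -> Prop) (A0 : submodClosed M) :
  noetherian M -> F A0 ->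
  exists A, F A /\ forall B : submodClosed M, F B -> {subset A <= B} -> {subset B <= A}.
Proof.
move=> noe FA0; apply: contrapT => /forallNP noM.
have next (A : {A | F A}) : exists B : {A | F A},
    {subset sval A <= sval B} /\ ~ {subset sval B <= sval A}.
  case: A => A FA; have /not_andP[//|/existsNP[B /not_implyP[FB /not_implyP[AB BA]]]] := noM A.
  by exists (exist _ B FB).
have /choice[f fP] := next.
pose A n := iter n f (exist _ A0 FA0).
have A_mono m n : (m <= n)%N -> {subset sval (A m) <= sval (A n)}.
  elim: n => [|n IH]; first by rewrite leqn0 => /eqP->.
  rewrite leq_eqVlt => /orP[/eqP-> //|]; rewrite ltnS => /IH mn x /mn.
  by have [+ _] := fP (A n); apply.
have U : is_submod (fun x => exists n, x \in sval (A n)).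
  split; first by exists 0%N; rewrite rpred0.
  move=> a x y [n xn] [m ym]; exists (maxn n m).
  rewrite rpredD ?rpredZ //; first exact: A_mono (leq_maxl _ _) _ _.
  exact: A_mono (leq_maxr _ _) _ _.
have [s [sU smin]] := noe (sub_of U).
have [n sn] : exists n, forall x, x \in s -> x \in sval (A n).
  elim: s sU {smin} => [|x s IH] sU; first by exists 0%N.
  have [|n sn] := IH; first by move=> y ys; apply: sU; rewrite inE ys orbT.
  have /sub_ofP[m xm] : x \in sub_of U by apply: sU; rewrite mem_head.
  exists (maxn n m) => y; rewrite inE => /orP[/eqP->|/sn yn].
    exact: A_mono (leq_maxr _ _) _ _.
  exact: A_mono (leq_maxl _ _) _ _.
have [_ []] := fP (A n) => x xf.
by apply: smin sn _ _; apply/sub_ofP; exists n.+1.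
Qed.

Lemma noetherian_extension M N (f : {linear M -> N}) :
  noetherian N -> noetherian (submodule_of (sub_of (ker_submod f))) -> noetherian M.
Proof.
move=> noeN noeK A; set K := sub_of (ker_submod f).
have [s [sA smin]] := noeN (sub_of (im_submod (f \o incl A))).
have [t [tA ts]] : exists t : seq M, (forall x, x \in t -> x \in A) /\
    forall y, y \in s -> exists2 x, x \in t & f x = y.
  elim: s sA {smin} => [|y s IH] sA; first by exists [::].
  have [|t [tA ts]] := IH; first by move=> z zs; apply: sA; rewrite inE zs orbT.
  have /sub_ofP[a ay] : y \in sub_of (im_submod (f \o incl A)) by apply: sA; rewrite mem_head.
  exists (val a :: t); split=> [x|z].
    by rewrite inE => /orP[/eqP->|/tA //]; exact: valP.
  rewrite inE => /orP[/eqP->|/ts[x xt xz]]; first by exists (val a); rewrite ?mem_head.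
  by exists x => //; rewrite inE xt orbT.
have [u [uA umin]] := noeK (sub_of (preim_submod (incl K) A)).
exists (t ++ map val u); split.
  move=> x; rewrite mem_cat => /orP[/tA //|/mapP[z /uA /sub_ofP zA ->]].
  exact: zA.
move=> B tB x xA.
have hC : is_submod (fun x => x \in A /\ x \in B).
  by split=> [|a y z [yA yB] [zA zB]]; rewrite ?rpred0 // !rpredD ?rpredZ.
have : f x \in sub_of (im_submod (f \o incl (sub_of hC))).
  apply: smin; last by apply/sub_ofP; exists (Sub x xA).
  move=> y /ts[z zt <-]; apply/sub_ofP.
  have zC : z \in sub_of hC.
    by apply/sub_ofP; split; [exact: tA|apply: tB; rewrite mem_cat zt].
  by exists (Sub z zC).
move=> /sub_ofP[b /= fb]; have /sub_ofP[bA bB] := valP b.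
have xbK : x - val b \in K by apply/sub_ofP; rewrite linearB fb subrr.
rewrite -[x](subrK (val b)) rpredD //.
have /sub_ofP : Sub (x - val b) xbK \in sub_of (preim_submod (incl K) B).
  apply: umin => [z zu|]; last by apply/sub_ofP; exact: submod_sub.
  by apply/sub_ofP/tB; rewrite mem_cat map_f ?orbT.
by [].
Qed.

Lemma noetherian_rV n : @noetherian R R^o -> @noetherian R 'rV[R]_n.
Proof.
move=> noe; elim: n => [|n IH].
  move=> A; exists [::]; split=> // B _ x _.
  by rewrite (_ : x = 0) ?rpred0 //; apply/rowP => -[].
have hl : linear (fun v : 'rV[R]_n.+1 => v 0 0 : R^o) by move=> a u v; rewrite !mxE.
apply: (@noetherian_extension _ _ (lin_of hl)) => //.
have kl : linear (fun v : 'rV[R]_n.+1 => \row_i v 0 (lift 0 i)).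
  by move=> a u v; apply/rowP => i; rewrite !mxE.
apply: (@noetherian_inj _ _ _ (lin_of kl \o incl _)) IH.
apply: linear_inj => v /= /rowP v0; apply: incl_inj; apply/rowP => i.
rewrite linear0 mxE; have [j ->|->] := unliftP 0 i; first by have := v0 j; rewrite !mxE.
by have /sub_ofP := valP v.
Qed.

(** The kernels of the iterates stabilise: if [h x = 0] and [x] is the [n]-th iterate at [y], then
    [y] is in the kernel of iterate [n.+1], hence of iterate [n]. *)
Lemma noetherian_surj_inj M (h : {linear M -> M}) :
  noetherian M -> surjective h -> injective h.
Proof.
move=> noe hs.
have itl n : linear (iter n h).
  by elim: n => // n IH a x y; rewrite /= IH linearP.
pose K n := sub_of (ker_submod (lin_of (itl n))).
have [_ [[n ->] Kmax]] := noetherian_maximal (F := fun A => exists n, A = K n) noe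
  (ex_intro _ 0%N erefl).
have its : forall m y, exists x, iter m h x = y.
  elim=> [|m IH] y; first by exists y.
  by have [z <-] := hs y; have [x <-] := IH z; exists x.
apply: linear_inj => x hx; have [y yx] := its n x.
rewrite -yx; apply/(sub_ofP (ker_submod (lin_of (itl n)))).
apply: (Kmax (K n.+1)); first by exists n.+1.
  by move=> z /sub_ofP zn; apply/sub_ofP; rewrite lin_ofE /= [iter n h z]zn linear0.
by apply/sub_ofP; rewrite lin_ofE /= yx.
Qed.

(** * Right coherence of left noetherian left hereditary rings *)

Section Coherent.
Hypotheses (hR : left_hereditary R) (noe : @noetherian R R^o).

Lemma row_ext m n (A B : 'M[R]_(m, n)) : (forall v : 'rV_m, v *m A = v *m B) -> A = B.
Proof. by move=> AB; apply/row_matrixP => i; rewrite !rowE AB. Qed.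

(* Among the idempotent matrices [p] with [r p = 0] take one with maximal row space. *)
Lemma annihilator_idempotent n (r : 'rV[R]_n) :
  exists p : 'M[R]_n, r *m p = 0 /\ forall s : 'cV[R]_n, r *m s = 0 -> p *m s = s.
Proof.
have fixs (p : 'M[R]_n) : @is_submod R 'rV[R]_n (fun v => v *m p = v).
  by split=> [|a u v up vp]; rewrite ?mul0mx // mulmxDl -scalemxAl up vp.
have [_ [[p [pp rp ->]] pmax]] := noetherian_maximal
  (F := fun A => exists p, [/\ p *m p = p, r *m p = 0 & A = sub_of (fixs p)])
  (@noetherian_rV n noe) (ex_intro _ 0 (And3 (mulmx0 _ _) (mulmx0 _ _) erefl)).
exists p; split=> // s rs.
pose s' := s - p *m s.
have ps' : p *m s' = 0 by rewrite mulmxBr mulmxA pp subrr.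
have rs' : r *m s' = 0 by rewrite mulmxBr rs mulmxA rp mul0mx subr0.
have fl : linear (fun v : 'rV[R]_n => (v *m s') 0 0 : R^o).
  by move=> a u v; rewrite mulmxDl -scalemxAl !mxE.
have f0 (v : 'rV[R]_n) : lin_of fl v = 0 <-> v *m s' = 0.
  split=> v0; last by rewrite lin_ofE v0 mxE.
  by apply/matrixP => i j; rewrite !ord1 [RHS]mxE.
have [e [fe e0]] := kernel_split hR (lin_of fl) (regular_projective hR).
pose q := lin1_mx e.
have vq (v : 'rV_n) : v *m q = e v by exact: mul_rV_lin1.
have qs' : q *m s' = s'.
  apply: row_ext => v; rewrite mulmxA vq.
  have /eqP := fe v; rewrite -subr_eq0 -linearB => /eqP/f0/eqP.
  by rewrite mulmxBl subr_eq0 => /eqP.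
have pq : p *m q = 0.
  by apply: row_ext => v; rewrite mulmxA vq mulmx0; apply/e0/f0; rewrite -mulmxA ps' mulmx0.
have rq : r *m q = 0 by rewrite vq; exact/e0/f0.
have qq : q *m q = q.
  apply: row_ext => v; rewrite mulmxA !vq; apply/eqP; rewrite -subr_eq0 -linearB.
  by apply/eqP/e0; rewrite linearB fe subrr.
(* This idempotent fixes the rows of [p] and of [q]. By maximality the rows of [p'] are fixed by
   [p], so [s' = p' s'] is killed along with [p s']. *)
pose p' := p + q - q *m p.
have p's' : p' *m s' = s' by rewrite mulmxBl mulmxDl -mulmxA ps' mulmx0 qs' add0r subr0.
have pp'E : p *m p' = p.
  by rewrite mulmxBr mulmxDr pp mulmxA pq mul0mx addr0 subr0.
have qp'E : q *m p' = q.
  by rewrite mulmxBr mulmxDr mulmxA qq addrAC subrr add0r.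
have p'p' : p' *m p' = p' by rewrite {1}/p' mulmxBl mulmxDl -mulmxA pp'E qp'E.
have rp' : r *m p' = 0.
  by rewrite mulmxBr mulmxDr mulmxA rp rq mul0mx addr0 subr0.
have sub : {subset sub_of (fixs p) <= sub_of (fixs p')}.
  by move=> v /sub_ofP vp; apply/sub_ofP; rewrite -vp -mulmxA pp'E.
have {}pmax : {subset sub_of (fixs p') <= sub_of (fixs p)}.
  by apply: pmax => //; exists p'.
have s'0 : s' = 0.
  apply: row_ext => v; rewrite mulmx0 -p's' mulmxA.
  have /sub_ofP <- : v *m p' \in sub_of (fixs p).
    by apply: pmax; apply/sub_ofP; rewrite -mulmxA p'p'.
  by rewrite -mulmxA ps' mulmx0.
by apply/eqP; rewrite eq_sym -subr_eq0; apply/eqP.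
Qed.

(** The relations between generators [r] of a right ideal form the column image of [p]. Rows over
    [R^c] are columns over [R], so [p] appears transposed as [P]. *)
Lemma noetherian_hereditary_right_coherent : right_coherent R.
Proof.
move=> L [n [f fs]].
pose r : 'rV[R]_n := \row_i (val (f (delta_mx 0 i)) : R).
pose tc (v : 'rV[R^c]_n) : 'cV[R]_n := \col_i (v 0 i : R).
have [p [rp pP]] := annihilator_idempotent r.
pose P : 'M[R^c]_n := \matrix_(k, i) (p i k : R^c).
have fE v : f v = 0 <-> r *m tc v = 0.
  have valf : val (f v) = (r *m tc v) 0 0 :> R.
    rewrite [v in LHS]row_sum_delta !linear_sum !mxE.
    by apply: eq_bigr => i _; rewrite !linearZ !mxE.
  split=> [fv|v0]; last by apply: incl_inj; rewrite linear0; rewrite [LHS]valf v0 mxE.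
  by apply/matrixP => i j; rewrite !ord1 -valf fv [RHS]mxE.
have tcP v : tc (v *m P) = p *m tc v.
  by apply/colP => i; rewrite !mxE; apply: eq_bigr => k _; rewrite !mxE.
exists n, n, (mulmxr P), f; split=> // v; split=> [/fE/pP pv|[u <-]]; last first.
  by apply/fE; rewrite /= tcP mulmxA rp mul0mx.
exists v; apply/rowP => i; have /colP/(_ i) := tcP v.
by rewrite pv !mxE.
Qed.

End Coherent.
End NoetherianRing.

(** * Decomposition of the unit *)

Section QF3plus.
Variables (R : pzRingType) (I : lmodType R) (iota : {linear R^o -> I}).
Hypotheses (hR : left_hereditary R) (hI : injective_envelope iota).
Hypothesis projI : projective I.
Implicit Types D M N P Q E : lmodType R.

Lemma iota_scale (a b : R) : iota (a * b) = a *: iota b.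
Proof. exact: (linearZ_LR iota a (b : R^o)). Qed.

(** A dual basis functional vanishing at [iota 1] vanishes on [R], hence on [I] by essentiality;
    only finitely many remain. *)
Lemma envelope_generated : exists s : seq I, generated_by s (fun _ => True).
Proof.
case: hI => _ _ ess; have [phi [lf bas]] := dual_basis projI.
have [s sP] := lf (iota 1); exists s; split=> // B sB x _.
apply: (dual_basis_sub lf bas) => y phiy; apply: sB; apply: contrapT => /negP ys; apply: phiy.
apply: (essential_zero hR ess (regular_projective hR)) => r.
by rewrite -[r]mulr1 iota_scale linearZ /= sP // scaler0.
Qed.

Lemma envelope_noetherian : noetherian I.
Proof.
have [injI _ _] := hI; have [s sP] := envelope_generated.
exact: (injective_projective_noetherian hR injI projI sP).
Qed.

Lemma ring_noetherian : @noetherian R R^o.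
Proof. by have [_ ii _] := hI; exact: noetherian_inj ii envelope_noetherian. Qed.

Lemma QF3plus_right_coherent : right_coherent R.
Proof. exact: noetherian_hereditary_right_coherent hR ring_noetherian. Qed.

Lemma mulr_linear (a : R) : linear (fun x : R^o => x * a : R^o).
Proof. by move=> c x y; rewrite mulrDl -[_ *: _]/(c * x) -mulrA. Qed.

(** Right multiplication by [a] extends to an injective [g] on [I], whose retraction is bijective
    because [I] is noetherian. The submodules [X n] of elements sent into [R] by the [n]-th iterate
    of [g] increase and stabilise; pulling 1 back [n.+1] times and pushing it forward [n] times
    therefore lands in [R], at a left inverse of [a]. *)
Lemma left_regular_left_invertible (a : R) : (forall x, x * a = 0 -> x = 0) ->
  exists b, b * a = 1.
Proof.
move=> areg; have [injI ii ess] := hI.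
have [g gP] := injI _ _ iota (iota \o lin_of (mulr_linear a)) ii.
have g_inj : injective g.
  apply: linear_inj => y gy; apply: (ess (sub_of (ker_submod g))); last exact/sub_ofP.
  move=> x /sub_ofP; rewrite gP => /(inj_linear0 ii)/areg ->; exact: linear0.
have [h hg] := injI _ _ g idfun g_inj.
have h_inj : injective h.
  by apply: noetherian_surj_inj envelope_noetherian _ => y; exists (g y); rewrite hg.
have gs y : exists x, g x = y by exists (h y); apply: h_inj; rewrite hg.
have itl n : linear (iter n g) by elim: n => // n IH c x y; rewrite /= IH linearP.
pose X n := sub_of (preim_submod (lin_of (itl n)) (sub_of (im_submod iota))).
have [_ [[n ->] Xmax]] := noetherian_maximal (F := fun A => exists n, A = X n)
  envelope_noetherian (ex_intro _ 0%N erefl).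
have XP m y : y \in X m <-> exists r, iota r = iter m g y.
  by split=> [/sub_ofP/sub_ofP|ry]; [|apply/sub_ofP/sub_ofP].
have [x xE] : exists x, iter n.+1 g x = iota 1.
  elim: n.+1 => [|m [x xE]]; first by exists (iota 1).
  by have [z zx] := gs x; exists z; rewrite iterSr zx.
have /XP[r rx] : x \in X n.
  apply: (Xmax (X n.+1)); first by exists n.+1.
    by move=> y /XP[r ry]; apply/XP; exists (r * a); rewrite /= -ry gP.
  by apply/XP; exists 1.
by exists r; apply: ii; rewrite -xE /= -rx gP.
Qed.

Lemma left_regular_unit (a : R) : (forall x, x * a = 0 -> x = 0) ->
  exists b, b * a = 1 /\ a * b = 1.
Proof.
move=> areg; have [b ba] := left_regular_left_invertible areg.
have [c cb] : exists c, c * b = 1.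
  apply: left_regular_left_invertible => x xb.
  by apply/areg; rewrite -[x]mulr1 -ba mulrA xb !mul0r.
by exists b; split=> //; rewrite -[a]mul1r -cb -[c * b * a]mulrA ba mulr1.
Qed.

(** The kernel of right multiplication by [a] splits off through an endomorphism of [R], which is
    right multiplication by its value [e] at 1. *)
Lemma left_annihilator (a : R) :
  exists e, e * e = e /\ forall x, x * a = 0 <-> x * e = 0.
Proof.
have [f [af f0]] := kernel_split hR (lin_of (mulr_linear a)) (regular_projective hR).
pose e : R := f 1.
have fE (x : R) : f x = x * e :> R.
  by rewrite -[x in LHS]mulr1; exact: (linearZ_LR f x (1 : R^o)).
have ea : e * a = a by have := af 1; rewrite !lin_ofE mul1r.
have l x : x * a = 0 <-> x * e = 0.
  by split=> [xa|xe]; [rewrite -fE; exact: f0|rewrite -ea mulrA xe mul0r].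
exists e; split=> //; apply/eqP; rewrite eq_sym -subr_eq0 -{1}[e]mul1r -mulrBl.
by apply/eqP/l; rewrite mulrBl mul1r ea subrr.
Qed.

Definition division_idempotent (e : R) : Prop :=
  [/\ e <> 0, e * e = e &
      forall a, a <> 0 -> e * a * e = a -> exists b, [/\ e * b * e = b, a * b = e & b * a = e]].

Lemma mem_ker_mulr (e : R) : @is_submod R R^o (fun x => x * e = 0).
Proof.
split=> [|c x y xe ye]; first exact: mul0r.
by rewrite mulrDl -[_ *: _]/(c * x) -mulrA xe ye mulr0 addr0.
Qed.

(** Take [e] in [g R g] with maximal left annihilator. A nonzero [a] in [e R e] has the annihilator
    of an idempotent below [e], so that of [e]; then [a + (1 - e)] is regular, hence a unit, and
    compressing its inverse by [e] inverts [a]. *)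
Lemma division_idempotent_below (g : R) : g * g = g -> g <> 0 ->
  exists e, [/\ division_idempotent e, g * e = e & e * g = e].
Proof.
move=> gg g0.
pose F (A : submodClosed R^o) := exists e, [/\ e * e = e, e <> 0, g * e = e, e * g = e
  & A = sub_of (mem_ker_mulr e)].
have Fg : F (sub_of (mem_ker_mulr g)) by exists g.
have [_ [[e [ee e0 ge eg ->]] emax]] := noetherian_maximal ring_noetherian Fg.
exists e; split=> //; split=> // a a0 eae.
have ea : e * a = a by rewrite -eae !mulrA ee.
have ae : a * e = a by rewrite -eae -!mulrA ee.
have [e' [e'e' la]] := left_annihilator a.
have ee' : e * e' = e'.
  apply/eqP; rewrite eq_sym -subr_eq0 -{1}[e']mul1r -mulrBl; apply/eqP/la.
  by rewrite mulrBl mul1r ea subrr.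
have l'' x : x * (e' * e) = 0 <-> x * e' = 0.
  split=> [x0|x0]; last by rewrite mulrA x0 mul0r.
  have -> : x * e' = x * (e' * e) * e' by rewrite -!mulrA ee' e'e'.
  by rewrite x0 mul0r.
have xa_xe x : x * a = 0 -> x * e = 0.
  move=> /la/l'' x0.
  apply/(sub_ofP (mem_ker_mulr e)); apply: (emax (sub_of (mem_ker_mulr (e' * e)))).
  - exists (e' * e); split=> //.
    + by rewrite mulrA -[_ * e * e']mulrA ee' e'e'.
    + by move=> e''0; apply: a0; rewrite -[a]mul1r; apply/la/l''; rewrite mul1r.
    + by rewrite -ee' -[e * e' * e]mulrA mulrA ge.
    + by rewrite -mulrA eg.
  - by move=> y /sub_ofP ye; apply/sub_ofP; rewrite -ee' !mulrA ye !mul0r.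
  - exact/sub_ofP.
pose c := a + (1 - e).
have ce : c * e = a by rewrite mulrDl mulrBl mul1r ee subrr addr0.
have ec : e * c = a by rewrite mulrDr mulrBr mulr1 ee subrr addr0.
have [x xc|b [bc cb]] := @left_regular_unit c.
  have xa : x * a = 0 by rewrite -ce mulrA xc mul0r.
  by move: xc; rewrite mulrDr xa add0r mulrBr mulr1 (xa_xe _ xa) subr0.
exists (e * b * e); split.
- by rewrite !mulrA ee -mulrA ee.
- by rewrite !mulrA ae -ec -(mulrA e) cb mulr1 ee.
- by rewrite -mulrA ea -ce mulrA -(mulrA e) bc mulr1 ee.
Qed.

(** Take an idempotent sum [f] with [R f] maximal; if [f] is not 1, a division idempotent below
    [1 - f] is orthogonal to [f] and enlarges it. *)
Lemma division_decomposition :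
  exists s : seq R, (forall e, e \in s -> division_idempotent e) /\ \sum_(e <- s) e = 1.
Proof.
have fixs (f : R) : @is_submod R R^o (fun x => x * f = x).
  by split=> [|c x y xf yf]; rewrite ?mul0r // mulrDl -[_ *: _]/(c * x) -mulrA xf yf.
pose F (A : submodClosed R^o) := exists s : seq R,
  [/\ forall e, e \in s -> division_idempotent e,
      (\sum_(e <- s) e) * (\sum_(e <- s) e) = \sum_(e <- s) e
    & A = sub_of (fixs (\sum_(e <- s) e))].
have F0 : F (sub_of (fixs (\sum_(e <- [::]) e))).
  by exists [::]; split=> //; rewrite big_nil mul0r.
have [_ [[s [sD ff ->]] smax]] := noetherian_maximal ring_noetherian F0.
exists s; split=> //; set f := \sum_(e <- s) e in ff smax *.
apply: contrapT => f1.
have [||e [eD ge eg]] := @division_idempotent_below (1 - f).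
- by rewrite mulrBl mul1r mulrBr mulr1 ff subrr subr0.
- by move=> /eqP; rewrite subr_eq0 => /eqP f1'; apply: f1.
have [e0 ee _] := eD.
have fe : f * e = 0 by rewrite -ge mulrA mulrBr mulr1 ff subrr mul0r.
have ef : e * f = 0 by rewrite -eg -mulrA mulrBl mul1r ff subrr mulr0.
have sE : \sum_(x <- e :: s) x = e + f by rewrite big_cons.
apply: e0; rewrite -ef; apply/esym/(sub_ofP (fixs f)).
apply: (smax (sub_of (fixs (\sum_(x <- e :: s) x)))).
- exists (e :: s); split=> //; rewrite ?sE.
    by move=> x; rewrite inE => /orP[/eqP->|/sD].
  by rewrite mulrDl !mulrDr ee ef fe ff addr0 add0r.
- move=> x /sub_ofP xf; apply/sub_ofP.
  have xe : x * e = 0 by rewrite -xf -mulrA fe mulr0.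
  by rewrite sE mulrDr xe xf add0r.
- by apply/sub_ofP; rewrite sE mulrDr ee ef addr0.
Qed.

End QF3plus.

(** * The radical and projective covers *)

Section Semiprimary.
Variable R : pzRingType.
Variable s : seq R.
Hypotheses (sD : forall e, e \in s -> division_idempotent e) (s1 : \sum_(e <- s) e = 1).
Implicit Types D M N P Q E : lmodType R.

(* The Jacobson radical: since [e R e] is a division ring, [e r b e <> 0] would make
   [e] factor through [r]. *)
Definition in_rad (r : R) : Prop := forall e, e \in s -> forall b, e * r * b * e = 0.

Lemma in_rad0 : in_rad 0.
Proof. by move=> e _ b; rewrite mulr0 !mul0r. Qed.

Lemma sum_decomposition (x y : R) : x * y = \sum_(e <- s) x * e * y.
Proof. by rewrite -{1}[x]mulr1 -s1 mulr_sumr mulr_suml. Qed.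

Lemma division_factor e x y : e \in s -> e * x = x -> y * e = y -> x * y <> 0 ->
  exists c, [/\ e * c * e = c, x * y * c = e & c * (x * y) = e].
Proof.
move=> es ex ye xy0; have [_ ee div] := sD es.
by have [|c [ce xyc cxy]] := div _ xy0; [rewrite mulrA ex -mulrA ye|exists c].
Qed.

(** If [x * y] were nonzero with inverse [c], then [e], the square of [x y c], would contain the
    factor [y c x], which vanishes because [r] is radical. *)
Lemma in_radMl r t : in_rad r -> in_rad (t * r).
Proof.
move=> hr e es b; have [e0 ee _] := sD es.
have -> : e * (t * r) * b * e = (e * t) * (r * b * e) by rewrite !mulrA.
rewrite sum_decomposition big_seq big1 // => e' e's.
have [_ e'e' _] := sD e's.
pose x := e * t * e'; pose y := e' * (r * b * e).
have -> : e * t * e' * (r * b * e) = x * y by rewrite /x /y !mulrA -(mulrA _ e' e') e'e'.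
apply: contrapT => xy0.
have [||c [_ xyc _]] := division_factor es _ _ xy0.
- by rewrite /x !mulrA ee.
- by rewrite /y -!mulrA ee.
have ycx : y * c * x = 0.
  have -> : y * c * x = e' * r * (b * e * c * e * t) * e' by rewrite /x /y !mulrA.
  exact: hr.
apply: e0; rewrite -ee -{1}xyc -xyc.
have -> : x * y * c * (x * y * c) = x * (y * c * x) * (y * c) by rewrite !mulrA.
by rewrite ycx mulr0 mul0r.
Qed.

(** [V] collects idempotents [e] with [z R e = 0]. Writing 1 as the sum of [s] between [z] and a
    radical factor [r], each nonzero [z e r] also kills [R e], so [V] grows until it covers [s]. Its
    size is counted by occurrences in [s], which may have repetitions. *)
Lemma prod_in_rad_zero n (V : seq R) (z : R) :
  (forall e, e \in V -> forall b, z * b * e = 0) ->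
  (size s <= n + count (mem V) s)%N ->
  forall rs : seq R, size rs = n -> (forall r, r \in rs -> in_rad r) ->
  z * \prod_(r <- rs) r = 0.
Proof.
elim: n V z => [|n IH] V z zV sV rs.
  move=> /size0nil -> _; rewrite big_nil sum_decomposition big_seq big1 // => e es.
  have : all (mem V) s by rewrite all_count eqn_leq count_size.
  move=> /allP/(_ e es) eV.
  by have := zV e eV 1; rewrite !mulr1.
case: rs => // r rs [rsn] rsJ; rewrite big_cons mulrA.
have zr0 e : e \in s -> z * e * r * \prod_(r <- rs) r = 0.
  move=> es; have [eV|neV] := boolP (e \in V).
    by have := zV e eV 1; rewrite mulr1 => ->; rewrite !mul0r.
  apply: (IH (e :: V)) => //.
  - move=> e' e'V b; move: e'V; rewrite inE => /orP[/eqP->|/zV ze'].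
      have := rsJ r (mem_head _ _) e es b; rewrite -!mulrA => ->; exact: mulr0.
    by rewrite -!mulrA (mulrA e) (mulrA (e * r)) mulrA.
  - apply: leq_trans sV _; rewrite addSn -addnS leq_add2l.
    have := count_predUI (pred1 e) (mem V) s.
    rewrite (@eq_count _ (predI _ _) pred0); last first.
      by move=> x; rewrite /= -topredE /=; case: eqVneq => //= ->; exact: negbTE.
    rewrite count_pred0 addn0 => ce.
    rewrite (@eq_count _ (mem (e :: V)) (predU (pred1 e) (mem V))); last by move=> x; rewrite /= inE.
    by rewrite ce -add1n leq_add2r -has_count; apply/hasP; exists e => //=.
  - by move=> r' r's; apply: rsJ; rewrite inE r's orbT.
have -> : z * r * \prod_(j <- rs) j = \sum_(e <- s) z * e * (r * \prod_(j <- rs) j).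
  by rewrite -sum_decomposition mulrA.
by rewrite big_seq big1 // => e es; rewrite mulrA zr0.
Qed.

Lemma in_rad_nilpotent (rs : seq R) : size rs = size s -> (forall r, r \in rs -> in_rad r) ->
  \prod_(r <- rs) r = 0.
Proof.
move=> rsn rsJ; rewrite -[LHS]mul1r; apply: (@prod_in_rad_zero (size s) [::]) => //.
by rewrite leq_addr.
Qed.

(** Inverting a nonzero [e' a b e'] yields a nonzero idempotent [u] of [e R e] that is a left
    multiple of [a]; in a division ring it must be [e]. So [R e] is generated by any of its elements
    outside the radical. *)
Lemma not_in_rad e a : e \in s -> a * e = a -> ~ in_rad a -> exists c, c * a = e.
Proof.
move=> es ae /existsNP[e' /not_implyP[e's /existsNP[b ab0]]].
have [e0 ee div] := sD es; have [e'0 e'e' _] := sD e's.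
pose x := e' * a; pose y := e * b * e'.
have xyE : x * y = e' * a * b * e' by rewrite /x /y !mulrA -(mulrA e') ae.
have [|||c [ce xyc _]] := @division_factor e' x y e's; rewrite ?xyE //.
- by rewrite /x mulrA e'e'.
- by rewrite /y -mulrA e'e'.
pose u := y * c * x.
have xu : x * u = x.
  have -> : x * u = x * y * c * x by rewrite /u !mulrA.
  by rewrite xyc /x mulrA e'e'.
have uu : u * u = u by rewrite {1}/u -mulrA xu.
have eue : e * u * e = u by rewrite /u /x /y !mulrA ee -!mulrA ae.
have u0 : u <> 0.
  by move=> u0; move: xu; rewrite u0 mulr0 => x0; apply: ab0; rewrite -xyE -x0 mul0r.
have [d [_ ud _]] := div u u0 eue.
have ue : u * e = u by rewrite -eue -mulrA ee.
exists (y * c * e'); have -> : y * c * e' * a = u by rewrite /u /x !mulrA.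
by rewrite -ue -{1}ud mulrA uu ud.
Qed.

Section RadMod.
Variable M : lmodType R.

Lemma rad_submod : is_submod (fun y : M =>
  forall B : submodClosed M, (forall r x, in_rad r -> r *: x \in B) -> y \in B).
Proof.
split=> [B _|a x y hx hy B hB]; first exact: rpred0.
by rewrite rpredD ?rpredZ ?hx ?hy.
Qed.

Definition rad_mod : submodClosed M := sub_of rad_submod.

Lemma rad_modZ r x : in_rad r -> r *: x \in rad_mod.
Proof. by move=> hr; apply/sub_ofP => B; apply. Qed.

(** By nilpotency: products of [size s - k] radical elements map [M] into [A], by induction on [k]
    from the zero products of length [size s]. *)
Lemma nakayama (A : submodClosed M) :
  (forall x, exists a j, [/\ a \in A, j \in rad_mod & x = a + j]) -> forall x, x \in A.
Proof.
move=> AJ x.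
have key k : (k <= size s)%N -> forall rs x, size rs = (size s - k)%N ->
    (forall r, r \in rs -> in_rad r) -> (\prod_(r <- rs) r) *: x \in A.
  elim: k => [_ rs y|k IH ks rs y rsk rsJ].
    by rewrite subn0 => ? ?; rewrite in_rad_nilpotent // scale0r rpred0.
  have [a [j [aA jJ ->]]] := AJ y.
  rewrite scalerDr rpredD //; first exact: rpredZ.
  (* The scalar [b] makes the condition stable under scaling; on a generator [r *: z] it is
     absorbed, as [b * r] is again radical. *)
  have hB : is_submod (fun j => forall b, (\prod_(r <- rs) r * b) *: j \in A).
    split=> [b|c u v hu hv b]; first by rewrite scaler0 rpred0.
    by rewrite scalerDr scalerA -mulrA rpredD.
  suff /sub_ofP jB : j \in sub_of hB by move: (jB 1); rewrite mulr1.
  have /sub_ofP := jJ; apply=> r z hr; apply/sub_ofP => b.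
  rewrite scalerA -mulrA.
  have -> : \prod_(r <- rs) r * (b * r) = \prod_(r <- rcons rs (b * r)) r.
    by rewrite -cats1 big_cat big_seq1.
  apply: IH; first exact: ltnW.
    by rewrite size_rcons rsk subnSK.
  by move=> t; rewrite mem_rcons inE => /orP[/eqP->|/rsJ //]; exact: in_radMl.
by have := key _ (leqnn _) [::] x; rewrite subnn big_nil scale1r; apply.
Qed.

End RadMod.
End Semiprimary.

(** * Construction of projective covers *)

Section Cover.
Variable R : pzRingType.
Hypothesis hR : left_hereditary R.
Variable s : seq R.
Hypotheses (sD : forall e, e \in s -> division_idempotent e) (s1 : \sum_(e <- s) e = 1).
Variable M : lmodType R.

Let X : eqType := (M * R)%type.

Let ev_ex := free_mod_eval (fun k : X => k.1).

Let h : {linear free_mod R X -> M} := sval (cid ev_ex).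

Let h_single k c : h (free_single k c) = c *: k.1.
Proof.
rewrite (svalP (cid ev_ex) _ [:: k]) //.
  by rewrite big_seq1 free_singleE eqxx.
by move=> x; rewrite inE free_singleE => /negbTE ->.
Qed.

(* The direct sum of the modules [R e] over the pairs [(x, e)] in [Y]. *)
Let cover_submod (Y : set X) : is_submod (fun f : free_mod R X =>
  forall k, (val f k <> 0 -> Y k) /\ (val f k : R) * k.2 = val f k).
Proof.
split=> [k|a f g hf hg k]; first by rewrite linear0 mul0r; split.
have [[fY fk] [gY gk]] := (hf k, hg k).
have -> : val (a *: f + g) k = a * val f k + val g k :> R by [].
rewrite mulrDl -mulrA fk gk; split=> // fg0.
have [f0|/fY //] := pselect (val f k = 0).
by apply: gY => g0; apply: fg0; rewrite f0 g0 mulr0 addr0.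
Qed.

Let cover (Y : set X) := sub_of (cover_submod Y).

Let single_cover (Y : set X) k c : Y k -> c * k.2 = c -> free_single k c \in cover Y.
Proof.
move=> Yk ck; apply/sub_ofP => x; rewrite free_singleE.
by case: eqP => [->|_]; rewrite ?mul0r.
Qed.

Let radM : submodClosed M := rad_mod s M.

(** Linear independence in [M] modulo its radical part, with the coefficients at [(x, e)] taken in
    [R e] modulo the radical. *)
Let independent (Y : set X) : Prop :=
  (forall k, Y k -> k.2 \in s /\ k.2 *: k.1 = k.1) /\
  (forall f, f \in cover Y -> h f \in radM -> forall k, in_rad s (val f k)).

(** If the coefficient [c] at the new index were not radical, some [d] with [d * c = e] would turn
    the relation into an expression of [e *: y] through [Y] modulo [radM]. *)
Let independent_extend (Y : set X) y e : independent Y -> e \in s ->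
  (forall f, f \in cover Y -> e *: y - h f \notin radM) ->
  independent (Y `|` [set (e *: y, e) : X])%classic.
Proof.
move=> [Ys Yind] es ny; have [e0 ee _] := sD es.
pose k : X := (e *: y, e).
split=> [_ [/Ys //|->]|f /sub_ofP fY hf]; first by rewrite /= scalerA ee.
pose c : R := val f k; have ce : c * e = c by have [_] := fY k.
pose f' := f - free_single k c.
have f'E x : val f' x = val f x - (if x == k then c else 0) :> R by [].
have f'Y : f' \in cover Y.
  apply/sub_ofP => x; rewrite f'E; have [->|xk] := eqVneq x k.
    by rewrite subrr mul0r; split.
  rewrite subr0; have [fx fx2] := fY x; split=> // /fx[//|xk'].
  by move: xk; rewrite xk' eqxx.
have fE : f = f' + free_single k c by rewrite subrK.
have cJ : in_rad s c.
  apply: contrapT => /(not_in_rad sD es ce)[d dc].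
  have := ny _ (rpredZ (- d) f'Y) => /negP; apply.
  rewrite linearZ /= scaleNr opprK.
  have -> : e *: y + d *: h f' = d *: h f.
    rewrite fE linearD h_single scalerDr addrC; congr (_ + _).
    by rewrite scalerA dc scalerA ee.
  exact: rpredZ.
have hf' : h f' \in radM.
  rewrite linearB h_single; apply: submod_sub => //; exact: rad_modZ.
move=> x; have := Yind _ f'Y hf' x; rewrite f'E.
have [->|_] := eqVneq x k; first by [].
by rewrite subr0.
Qed.

Let independent_bigcup (F : set (set X)) : (F !=set0)%classic ->
  (F `<=` independent)%classic -> total_on F subset -> independent (\bigcup_(Y in F) Y)%classic.
Proof.
move=> [Y0 FY0] FP Ft; split=> [k [Y FY Yk]|f /sub_ofP fU].
  by have [Ys _] := FP _ FY; exact: Ys.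
have /sub_ofP[t t0] := valP f.
have [Y FY tY] : exists2 Y, F Y & forall k, k \in t -> val f k <> 0 -> Y k.
  elim: t {t0} => [|k t [Y FY tY]]; first by exists Y0.
  have [f0|f0] := pselect (val f k = 0).
    by exists Y => // x; rewrite inE => /orP[/eqP->|/tY].
  have [Z FZ Zk] := (fU k).1 f0.
  have [YZ|ZY] := Ft _ _ FY FZ.
    by exists Z => // x; rewrite inE => /orP[/eqP->|/tY fx /fx /YZ].
  by exists Y => // x; rewrite inE => /orP[/eqP-> _|/tY //]; exact: ZY.
have [_ Yind] := FP _ FY; apply: Yind.
apply/sub_ofP => k; have [_ fk] := fU k; split=> // f0; apply: tY => //.
by apply: contrapT => /negP /t0.
Qed.

Lemma projective_cover_exists : exists (P : lmodType R) (p : {linear P -> M}), projective_cover p.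
Proof.
have [||Y [Yind _ Ymax]] := @zorn_above X independent set0.
- split=> // f /sub_ofP f0 _ k.
  have -> : val f k = 0 by apply: contrapT => /(f0 k).1.
  exact: in_rad0.
- exact: independent_bigcup.
have [Ys Yf] := Yind.
exists (submodule_of (cover Y)), (h \o incl (cover Y)); split.
- apply: (projective_sub hR).
  apply: (@projective_locally_finite _ hR _ X (@free_coord R X)).
    by move=> f; have /sub_ofP[t tP] := valP f; exists t.
  by move=> f f0; apply: free_ext => x; rewrite linear0; exact: f0.
- pose A := sub_of (im_submod (h \o incl (cover Y))).
  suff AM : forall y, y \in A by move=> y; have /sub_ofP := AM y.
  apply: (nakayama sD s1) => y.
  have hW : is_submod (fun y => exists a j, [/\ a \in A, j \in radM & y = a + j]).
    split; first by exists 0, 0; rewrite !rpred0 addr0.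
    move=> c _ _ [a [j [aA jJ ->]]] [a' [j' [a'A j'J ->]]].
    exists (c *: a + a'), (c *: j + j'); split; last by rewrite scalerDr addrACA.
      by rewrite rpredD ?rpredZ.
    by rewrite rpredD ?rpredZ.
  suff : y \in sub_of hW by move/sub_ofP.
  rewrite -[y]scale1r -s1 scaler_suml big_seq rpred_sum // => e es.
  apply/sub_ofP; apply: contrapT => nW.
  have [e0 ee _] := sD es.
  have Yk : Y (e *: y, e).
    apply: (Ymax _ _ (independent_extend Yind es _)); [by left| |by right].
    move=> f fY; apply/negP => J; apply: nW; exists (h f), (e *: y - h f).
    split=> //; last by rewrite addrC subrK.
    by apply/sub_ofP; exists (Sub f fY).
  apply: nW; exists (e *: y), 0; rewrite rpred0 addr0; split=> //.
  have kY := single_cover Yk (ee : e * (e *: y, e).2 = e).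
  by apply/sub_ofP; exists (Sub (free_single (e *: y, e) e) kY); rewrite /= h_single /= scalerA ee.
- move=> A KA; apply: (nakayama sD s1) => f.
  have [g [a [hg aA ->]]] := KA f; exists a, g; split=> //; last exact: addrC.
  have /sub_ofP gY := valP g.
  have /sub_ofP[t t0] := valP (val g).
  have gJ : forall k, in_rad s (val (val g) k).
    by apply: Yf (valP g) _; rewrite [h _]hg rpred0.
  have tk k : exists u : submodule_of (cover Y),
      val u = free_single k (val (val g) k : R) /\ u \in rad_mod s (submodule_of (cover Y)).
    have [g0|/(gY k).1 Yk] := pselect (val (val g) k = 0).
      exists 0; rewrite rpred0; split=> //; apply: free_ext => x.
      by rewrite /= g0 if_same.
    have [ks _] := Ys _ Yk; have [_ ee _] := sD ks.
    have kY := single_cover Yk ee.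
    pose u : submodule_of (cover Y) := Sub (free_single k k.2) kY.
    exists ((val (val g) k : R) *: u); split; last exact: rad_modZ.
    apply: free_ext => x.
    rewrite -[LHS]/((val (val g) k : R) * (if x == k then k.2 else 0)) /=.
    by case: eqP => [_|_]; [exact: (gY k).2|rewrite mulr0].
  have /choice[u uP] := tk.
  have -> : g = \sum_(k <- undup t) u k.
    apply: incl_inj; rewrite linear_sum /= [LHS](@free_mod_sum_single _ _ _ (undup t)).
    - by apply: eq_bigr => k _; exact: (esym (uP k).1).
    - exact: undup_uniq.
    - by move=> x; rewrite mem_undup; exact: t0.
  by rewrite rpred_sum // => k _; exact: (uP k).2.
Qed.

End Cover.

Theorem theorem3p3 (R : pzRingType) (I : lmodType R) (iota : {linear R^o -> I})
    (hR : left_hereditary R) (hI : injective_envelope iota) :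
  [<-> left_QF3plus R;
       [/\ left_perfect R, right_coherent R & serre (@stable R)];
       [/\ left_perfect R, right_coherent R & localizing (@stable R)];
       [/\ left_perfect R, right_coherent R
         & forall M : lmodType R, exists S : submodClosed M,
             largest_stable_submodule S /\
             (forall x : M, x \in S <-> forall f : {linear M -> I}, f x = 0)];
       [/\ left_perfect R, right_coherent R
         & forall M : lmodType R, stable M ->
             forall A : submodClosed M, projective (submodule_of A) -> zero_submodule A];
       exists r : reflector (@projective R), preserves_monomorphisms r;
       exists r : reflector (@projective R),
         monomorphism_in (@projective R) (refl_map r iota)].
Proof.
have H12 : left_QF3plus R -> [/\ left_perfect R, right_coherent R & serre (@stable R)].
  move=> /(QF3plus_projective hR hI) projI; split.
  - have [s [sD s1]] := division_decomposition hR hI projI.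
    by move=> M; exact: (@projective_cover_exists R hR s sD s1 M).
  - exact: QF3plus_right_coherent hR hI projI.
  - exact: serre_stable hR hI projI.
tfae.
- exact: H12.
- by move=> [perf coh sst]; split=> //; exact: localizing_stable.
- by move=> [perf coh [sst _]]; split=> //; exact: (largest_stable_reject hR hI sst).
- by move=> [perf coh rej]; split=> // M; exact: (no_projective_submodule hR hI rej).
- move=> [perf coh nop]; apply: (reflector_preserves_mono hR) => // X.
  exact: projective_power.
- by move=> [r mono]; exists r; apply: mono => Q _ g h gh x; have [_ ii _] := hI; exact/ii/gh.
- by move=> [r mono]; exact: QF3plus_of_reflector mono.
Qed.
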